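(* Let $w$ satisfy (A1), fix $\delta\in(0,1/2)$, and suppose (A2) holds: $a_\delta(x)\ge \int_0^1 \widetilde w_\delta(x,y)\,dy$ for all $x\in\Omega$. Then $\widetilde{\mathcal N}_\delta:L^2(\Omega)\to L^2(\Omega)$ is invertible and there is $C=C(w,\delta)>0$ with $\|(\widetilde{\mathcal N}_\delta)^{-1}\|_{L^2\to L^2}\le C$; in particular, for every $f\in L^2(\Omega)$ the equation $\widetilde{\mathcal N}_\delta u=f$ has a unique solution $u\in L^2(\Omega)$.
   Context: Throughout, $\Omega=(0,1)$, $\delta\in(0,1/2)$ is the nonlocal horizon, $B_\delta(x)=(x-\delta,x+\delta)$, and $\chi_A$ denotes the indicator function of a set $A$. A function $w:[0,\infty)\to[0,\infty)$ satisfies (A1) if $w$ is continuous and nonincreasing on $[0,1)$, positive on $(0,1)$, $w(r)=0$ for $r\ge 1$, and $\int_{\mathbb R} w(|z|)|z|^2\,dz=2$. Set $w_\delta(x,y)=\delta^{-3}w(|x-y|/\delta)$, $a_\delta(x)=\int_0^1 w_\delta(x,y)\,dy$, and $b_\delta(x)=\frac{2}{(x+\delta)^2}\int_{x-\delta}^{0}(x-y)w_\delta(x,y)\,dy$ for $x\in(0,\delta)$, $b_\delta(x)=\frac{2}{(1-x+\delta)^2}\int_{1}^{x+\delta}(y-x)w_\delta(x,y)\,dy$ for $x\in(1-\delta,1)$, and $b_\delta(x)=0$ otherwise. The operator $\widetilde{\mathcal N}_\delta$ on $L^2(\Omega)$ is $\widetilde{\mathcal N}_\delta u(x)=a_\delta(x)u(x)-\int_0^1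 u(y)\big(w_\delta(x,y)-b_\delta(x)\chi_{[0,\delta]}(|y-x|)\big)\,dy$. (It is the integral form of the nonlocal Dirichlet problem $\mathcal L_\delta u-\mathcal M_\delta u=f$ in $\Omega$, $u=0$ on $(-\delta,0)\cup(1,1+\delta)$, where $\mathcal L_\delta u(x)=\int_{B_\delta(x)}(u(x)-u(y))w_\delta(x,y)dy$, $\mathcal M_\delta u(x)=\int_{B_\delta(x)\setminus\Omega}(u(x)+\mathcal G_\delta u(x)(y-x))w_\delta(x,y)dy$, and $\mathcal G_\delta u(x)=\frac{2}{(x+\delta)^2}\int_0^{x+\delta}u$ for $x\in(0,\delta)$, $\mathcal G_\delta u(x)=-\frac{2}{(1-x+\delta)^2}\int_{x-\delta}^1 u$ for $x\in(1-\delta,1)$, $0$ otherwise.) Define $\widetilde w_\delta(x,y)=|w_\delta(x,y)-b_\delta(x)\chi_{(0,\delta)}(|y-x|)|$. *)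

(* Defs.v *)
From HB Require Import structures.
From mathcomp Require Import all_boot all_order all_algebra.
From mathcomp Require Import all_classical all_reals all_analysis.
Set Implicit Arguments. Unset Strict Implicit. Unset Printing Implicit Defensive.
Import Order.TTheory GRing.Theory Num.Theory.
Import numFieldNormedType.Exports.
Local Open Scope classical_set_scope.
Local Open Scope ring_scope.

Section Defs.
Variable R : realType.
Local Notation leb := (@lebesgue_measure R).

Definition Omega : set R := `]0, 1[.

Definition chi (A : set R) (r : R) : R := if `[< A r >] then 1 else 0.

(* Assumption (A1) on w : [0,oo) -> [0,oo) (values on (-oo,0) are irrelevant) *)
Definition A1 (w : R -> R) : Prop :=
  (forall r, 0 <= r -> 0 <= w r) /\
  {within `[0, 1[, continuous w} /\
  (forall r s, 0 <= r -> r <= s -> s < 1 -> w s <= w r) /\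
  (forall r, 0 < r < 1 -> 0 < w r) /\
  (forall r, 1 <= r -> w r = 0) /\
  (\int[leb]_(z in [set: R]) (w `|z| * z ^+ 2)%:E = 2%:E)%E.

Definition w_d (w : R -> R) (delta x y : R) : R :=
  delta ^- 3 * w (`|x - y| / delta).

Definition a_d (w : R -> R) (delta x : R) : R :=
  \int[leb]_(y in `[0, 1]) w_d w delta x y.

Definition b_d (w : R -> R) (delta x : R) : R :=
  if (0 < x) && (x < delta) then
    2 / (x + delta) ^+ 2 * \int[leb]_(y in `[x - delta, 0]) ((x - y) * w_d w delta x y)
  else if (1 - delta < x) && (x < 1) then
    2 / (1 - x + delta) ^+ 2 * \int[leb]_(y in `[1, x + delta]) ((y - x) * w_d w delta x y)
  else 0.

Definition Ntilde (w : R -> R) (delta : R) (u : R -> R) (x : R) : R :=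
  a_d w delta x * u x
  - \int[leb]_(y in `[0, 1])
      (u y * (w_d w delta x y - b_d w delta x * chi `[0, delta] `|y - x|)).

Definition wtilde_d (w : R -> R) (delta x y : R) : R :=
  `| w_d w delta x y - b_d w delta x * chi `]0, delta[ (`|y - x|) |.

Definition A2 (w : R -> R) (delta : R) : Prop :=
  forall x, Omega x -> a_d w delta x >= \int[leb]_(y in `[0, 1]) wtilde_d w delta x y.

Definition L2 (u : R -> R) : Prop :=
  measurable_fun Omega u /\
  (\int[leb]_(x in Omega) ((u x) ^+ 2)%:E < +oo)%E.

Definition L2norm (u : R -> R) : R :=
  Num.sqrt (\int[leb]_(x in Omega) ((u x) ^+ 2)).

Definition eq_L2 (u v : R -> R) : Prop := ae_eq leb Omega u v.

End Defs.

(* Main.v *)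
Require Import Defs.
From HB Require Import structures.
From mathcomp Require Import all_boot all_order all_algebra.
From mathcomp Require Import all_classical all_reals all_analysis.
From mathcomp Require Import measurable_realfun ring lra.
Import Order.TTheory GRing.Theory Num.Theory.
Import numFieldNormedType.Exports.
Local Open Scope classical_set_scope.
Local Open Scope ring_scope.

(** Dividing by a(x), which is bounded above and away from 0, turns the equation
    into u - T u = f / a with T an integral operator of bounded kernel k = K / a,
    and (A2) says that k is sub-Markovian: the integral of |k(x, .)| is at most 1.
    Instead of a compactness argument we show that some power of T is a strict
    contraction in sup norm. For x in [delta/2, 3 delta/4] the integral of
    |k(x, .)| is strictly below 1; from there the contraction spreads, because
    k(x, y) is bounded below when |y - x| <= e and x is in [e, 1 - e]; once it
    holds on [e, 1 - e] with e small, it holds on (0, 1), because the mass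
    of |k(x, .)| outside [e, 1 - e] is at most 1/2. As T maps L2 into bounded functions,
    u = g + sum_j T^j (T g) with g = f / a solves the equation, with a bound, and
    a fixed point of T in L2 is bounded, hence 0. *)

(** * Integral operators with a bounded sub-Markovian kernel *)

Section KernelOperator.
Context d (T : measurableType d) (R : realType).
Context (mu : {sigma_finite_measure set T -> \bar R}) (D : set T).
Hypothesis mD : measurable D.
Hypothesis muD : (mu D < +oo)%E.

Lemma bounded_integrable (E : set T) (f : T -> R) (B : R) :
  measurable E -> E `<=` D ->
  measurable_fun E f -> (forall x, E x -> `|f x| <= B) ->
  mu.-integrable E (EFin \o f).
Proof.
move=> mE ED mf fB; apply: measurable_bounded_integrable => //.
  by rewrite (le_lt_trans _ muD)// le_measure// inE.
exists B; split; first exact: num_real.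
by move=> M BM x Ex; exact: (le_trans (fB x Ex) (ltW BM)).
Qed.

Definition sq_integrable (u : T -> R) :=
  measurable_fun D u /\ (\int[mu]_(x in D) ((u x) ^+ 2)%:E < +oo)%E.

Lemma sq_integrable_sqr (u : T -> R) : sq_integrable u ->
  mu.-integrable D (EFin \o (fun x => u x ^+ 2)).
Proof.
move=> [mfu u2]; apply/integrableP; split.
  by apply/measurable_EFinP; exact: measurable_funX.
under eq_integral do rewrite /= ger0_norm ?sqr_ge0//.
exact: u2.
Qed.

Lemma sqr_integrable_sq (u : T -> R) : measurable_fun D u ->
  mu.-integrable D (EFin \o (fun x => u x ^+ 2)) -> sq_integrable u.
Proof.
move=> mfu /integrableP[_ u2]; split=> //.
apply: le_lt_trans u2.
by under [leRHS]eq_integral do rewrite /= ger0_norm ?sqr_ge0//.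
Qed.

Lemma sq_integrable_integrable (u : T -> R) : sq_integrable u ->
  mu.-integrable D (EFin \o u).
Proof.
move=> su; have iu2 := sq_integrable_sqr u su.
have i1 : mu.-integrable D (EFin \o cst 1).
  by apply: (@bounded_integrable _ _ `|1|).
have i2 : mu.-integrable D (EFin \o (fun x => 1 + u x ^+ 2)).
  exact: (integrableD mD i1 iu2).
apply: (le_integrable mD _ _ i2).
  by apply/measurable_EFinP; exact: su.1.
move=> x Dx; rewrite /= lee_fin [leRHS]ger0_norm; last by rewrite addr_ge0// sqr_ge0.
by rewrite -(real_normK (num_real (u x))); have := normr_ge0 (u x); nra.
Qed.

Lemma sq_integrableD (u v : T -> R) : sq_integrable u -> sq_integrable v ->
  sq_integrable (u \+ v) /\
  \int[mu]_(x in D) ((u x + v x) ^+ 2) <=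
  2 * \int[mu]_(x in D) (u x ^+ 2) + 2 * \int[mu]_(x in D) (v x ^+ 2).
Proof.
move=> su sv; have iu := sq_integrable_sqr u su.
have iv := sq_integrable_sqr v sv.
have iu' : mu.-integrable D (EFin \o (fun x => 2 * u x ^+ 2)).
  exact: (@integrableZl _ _ _ mu D mD 2 (fun x => (u x ^+ 2)%:E)).
have iv' : mu.-integrable D (EFin \o (fun x => 2 * v x ^+ 2)).
  exact: (@integrableZl _ _ _ mu D mD 2 (fun x => (v x ^+ 2)%:E)).
have iuv : mu.-integrable D (EFin \o (fun x => 2 * u x ^+ 2 + 2 * v x ^+ 2)).
  exact: (integrableD mD iu' iv').
have muv : measurable_fun D (u \+ v) by apply: measurable_funD; [exact: su.1|exact: sv.1].
have le2 x : (u x + v x) ^+ 2 <= 2 * u x ^+ 2 + 2 * v x ^+ 2.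
  by have := sqr_ge0 (u x - v x); lra.
have i2 : mu.-integrable D (EFin \o (fun x => (u x + v x) ^+ 2)).
  apply: (le_integrable mD _ _ iuv).
    by apply/measurable_EFinP; exact: measurable_funX.
  move=> x Dx; rewrite /= lee_fin !ger0_norm ?sqr_ge0//.
  by rewrite addr_ge0// mulr_ge0// sqr_ge0.
split; first exact: sqr_integrable_sq.
rewrite -!RintegralZl// -RintegralD//.
exact: le_Rintegral.
Qed.

Lemma sq_integrableM (g u : T -> R) (M : R) : measurable_fun D g ->
  (forall x, D x -> `|g x| <= M) -> sq_integrable u ->
  sq_integrable (fun x => g x * u x) /\
  \int[mu]_(x in D) ((g x * u x) ^+ 2) <= M ^+ 2 * \int[mu]_(x in D) (u x ^+ 2).
Proof.
move=> mg gM su; have iu := sq_integrable_sqr u su.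
have iu' : mu.-integrable D (EFin \o (fun x => M ^+ 2 * u x ^+ 2)).
  exact: (@integrableZl _ _ _ mu D mD (M ^+ 2) (fun x => (u x ^+ 2)%:E)).
have mgu : measurable_fun D (fun x => g x * u x).
  by apply: measurable_funM => //; exact: su.1.
have le2 x : D x -> (g x * u x) ^+ 2 <= M ^+ 2 * u x ^+ 2.
  move=> Dx; rewrite exprMn ler_wpM2r ?sqr_ge0//.
  rewrite -(real_normK (num_real (g x))) lerXn2r ?nnegrE// ?gM//.
  exact: le_trans (gM x Dx).
have i2 : mu.-integrable D (EFin \o (fun x => (g x * u x) ^+ 2)).
  apply: (le_integrable mD _ _ iu').
    by apply/measurable_EFinP; exact: measurable_funX.
  move=> x Dx; rewrite /= lee_fin !ger0_norm ?sqr_ge0//; first exact: le2.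
  by rewrite mulr_ge0// sqr_ge0.
split; first exact: sqr_integrable_sq.
by rewrite -RintegralZl//; exact: le_Rintegral.
Qed.

Lemma sq_integrable_bounded (u : T -> R) (M : R) : measurable_fun D u ->
  (forall x, D x -> `|u x| <= M) -> sq_integrable u.
Proof.
move=> mfu uM; apply: sqr_integrable_sq => //.
apply: (@bounded_integrable _ _ (M ^+ 2)) => //; first exact: measurable_funX.
move=> x Dx; rewrite normrX lerXn2r ?nnegrE// ?uM//.
exact: le_trans (uM x Dx).
Qed.

Lemma Rintegral_cst_prob (r : R) : mu D = 1%E -> \int[mu]_(x in D) r = r.
Proof.
move=> D1; transitivity (r * fine (mu D)); first exact: Rintegral_cst.
by rewrite D1 mulr1.
Qed.

Lemma Rintegral_norm_le_sq (u : T -> R) : mu D = 1%E -> sq_integrable u ->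
  \int[mu]_(x in D) `|u x| <= Num.sqrt (\int[mu]_(x in D) (u x ^+ 2)).
Proof.
move=> D1 su; set m := leLHS.
have iu2 := sq_integrable_sqr u su.
have iu : mu.-integrable D (EFin \o (fun x => `|u x|)).
  by apply: integrable_norm; exact: sq_integrable_integrable.
have icst r : mu.-integrable D (EFin \o cst r).
  by apply: (@bounded_integrable _ _ `|r|).
have m0 : 0 <= m by exact: Rintegral_ge0.
have ium : mu.-integrable D (EFin \o (fun x => (2 * m) * `|u x|)).
  exact: (@integrableZl _ _ _ mu D mD (2 * m) (fun x => (`|u x|)%:E)).
rewrite -(ger0_norm m0) -sqrtr_sqr ler_wsqrtr//.
have : \int[mu]_(x in D) ((2 * m) * `|u x|) <=
       \int[mu]_(x in D) (u x ^+ 2 + m ^+ 2).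
  apply: le_Rintegral => //.
    exact: (integrableD mD iu2 (icst (m ^+ 2))).
  move=> x Dx; rewrite -(real_normK (num_real (u x))).
  by have := sqr_ge0 (`|u x| - m); lra.
rewrite RintegralZl// RintegralD//; last exact: icst.
rewrite Rintegral_cst_prob// -/m; lra.
Qed.

Context (k : T * T -> R) (B : R).
Hypothesis mk : measurable_fun setT k.
Hypothesis kB : forall x y, D x -> D y -> `|k (x, y)| <= B.
Hypothesis k1 : forall x, D x -> \int[mu]_(y in D) `|k (x, y)| <= 1.

Definition kernel_op (u : T -> R) (x : T) : R :=
  \int[mu]_(y in D) (u y * k (x, y)).

Lemma measurable_kernel_section (x : T) (E : set T) :
  measurable_fun E (fun y => k (x, y)).
Proof.
apply: (measurable_funS measurableT (@subsetT _ _)).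
exact: (measurableT_comp mk (pair1_measurable x)).
Qed.

Lemma measurable_Rintegral_section (f : T * T -> R) :
  measurable_fun setT f -> measurable_fun setT (fun x => \int[mu]_y f (x, y)).
Proof.
move=> mf.
pose F (x : T) : \bar R := (\int[mu]_y (f (x, y))%:E)%E.
suff h : measurable_fun [set: T] F.
  exact: (measurableT_comp (fine_measurable measurableT) h).
rewrite /F; under eq_fun do rewrite integralE.
have mf' : measurable_fun setT (EFin \o f) by exact/measurable_EFinP.
apply: emeasurable_funB.
- rewrite [X in measurable_fun _ X](_ : _ = fubini_F mu ((EFin \o f)^\+)%E).
    by apply: measurable_fun_fubini_tonelli_F => //; exact: measurable_funepos.
  by apply/funext => x; apply: eq_integral => y _; rewrite !funeposE.
- rewrite [X in measurable_fun _ X](_ : _ = fubini_F mu ((EFin \o f)^\-)%E).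
    by apply: measurable_fun_fubini_tonelli_F => //; exact: measurable_funeneg.
  by apply/funext => x; apply: eq_integral => y _; rewrite !funenegE.
Qed.

Lemma measurable_kernel_op (E : set T) (u : T -> R) :
  measurable_fun D u -> measurable_fun E (kernel_op u).
Proof.
move=> mfu; apply: (measurable_funS measurableT) => //.
have -> : kernel_op u = fun x => \int[mu]_y ((u \_ D) y * k (x, y)).
  apply/funext => x; rewrite /kernel_op Rintegral_mkcond.
  apply: eq_Rintegral => y _; rewrite !patchE.
  by case: ifPn => //; rewrite mul0r.
apply: (measurable_Rintegral_section (fun z => (u \_ D) z.2 * k z)).
apply: measurable_funM => //; apply: measurableT_comp => //.
exact/(measurable_restrictT _ mD).1.
Qed.


Let norm_kernel_integrable (E : set T) x : measurable E -> E `<=` D -> D x ->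
  mu.-integrable E (EFin \o (fun y => `|k (x, y)|)).
Proof.
move=> mE ED Dx; apply: (@bounded_integrable _ _ B) => //.
  by apply: measurableT_comp => //; exact: measurable_kernel_section.
by move=> y Ey; rewrite normr_id; apply: kB => //; exact: ED.
Qed.

Lemma integrable_mul_kernel u x : D x -> mu.-integrable D (EFin \o u) ->
  mu.-integrable D (EFin \o (fun y => u y * k (x, y))).
Proof.
move=> Dx iu; have mfu : measurable_fun D u.
  by apply/measurable_EFinP; exact: measurable_int iu.
have -> : EFin \o (fun y => u y * k (x, y)) =
    (fun y => (EFin \o u) y * (k (x, y))%:E)%E by apply/funext => y.
apply: integrableMl => //; first exact: measurable_kernel_section.
exists B; split; first exact: num_real.
by move=> M BM y Dy; exact: (le_trans (kB _ _ Dx Dy) (ltW BM)).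
Qed.

Lemma kernel_opD u v x : D x -> mu.-integrable D (EFin \o u) ->
  mu.-integrable D (EFin \o v) ->
  kernel_op (u \+ v) x = kernel_op u x + kernel_op v x.
Proof.
move=> Dx iu iv; rewrite /kernel_op -RintegralD//;
  [|exact: integrable_mul_kernel..].
by apply: eq_Rintegral => y _; rewrite /= mulrDl.
Qed.

Lemma kernel_opB u v x : D x -> mu.-integrable D (EFin \o u) ->
  mu.-integrable D (EFin \o v) ->
  kernel_op (u \- v) x = kernel_op u x - kernel_op v x.
Proof.
move=> Dx iu iv; rewrite /kernel_op -RintegralB//;
  [|exact: integrable_mul_kernel..].
by apply: eq_Rintegral => y _; rewrite /= mulrBl.
Qed.

Lemma kernel_op_ae u v x : measurable_fun D u -> measurable_fun D v ->
  ae_eq mu D u v -> kernel_op u x = kernel_op v x.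
Proof.
move=> mfu mv uv; rewrite /kernel_op /Rintegral; congr fine.
apply: ae_eq_integral => //.
- by apply/measurable_EFinP/measurable_funM => //; exact: measurable_kernel_section.
- by apply/measurable_EFinP/measurable_funM => //; exact: measurable_kernel_section.
- by apply: filterS uv => y /[apply] ->.
Qed.

Lemma kernel_op_le_split (E : set T) (u : T -> R) (M c : R) x :
  measurable E -> E `<=` D -> D x -> 0 <= M ->
  measurable_fun D u -> (forall y, D y -> `|u y| <= M) ->
  (forall y, E y -> `|u y| <= (1 - c) * M) ->
  `|kernel_op u x| <= M * (\int[mu]_(y in D) `|k (x, y)|
                            - c * \int[mu]_(y in E) `|k (x, y)|).
Proof.
move=> mE ED Dx M0 mfu uM uE.
have iu : mu.-integrable D (EFin \o u) by exact: bounded_integrable uM.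
have iuk := integrable_mul_kernel u x Dx iu.
apply: (le_trans (le_normr_Rintegral mD iuk)).
have mE' : measurable (D `\` E) by exact: measurableD.
have DE : D = E `|` (D `\` E) by rewrite setDUK.
have dE : [disjoint E & D `\` E] by apply/disj_setPS => y [? []].
have iuk' : mu.-integrable D (EFin \o (fun y => `|u y * k (x, y)|)).
  exact: integrable_norm.
have ik' := norm_kernel_integrable D x mD (@subset_refl _ D) Dx.
have -> : \int[mu]_(t in D) `|u t * k (x, t)| =
   \int[mu]_(t in E) `|u t * k (x, t)| + \int[mu]_(t in D `\` E) `|u t * k (x, t)|.
  by rewrite [X in \int[mu]_(_ in X) _ = _]DE Rintegral_setU// -DE.
have -> : \int[mu]_(t in D) `|k (x, t)| =
   \int[mu]_(t in E) `|k (x, t)| + \int[mu]_(t in D `\` E) `|k (x, t)|.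
  by rewrite [X in \int[mu]_(_ in X) _ = _]DE Rintegral_setU// -DE.
have h1 : \int[mu]_(t in E) `|u t * k (x, t)| <=
    ((1 - c) * M) * \int[mu]_(t in E) `|k (x, t)|.
  rewrite -RintegralZl//; last exact: norm_kernel_integrable.
  apply: le_Rintegral => //.
  - exact: integrableS iuk'.
  - by apply: (@integrableZl _ _ _ mu E mE _ (fun y => (`|k (x, y)|)%:E));
      exact: norm_kernel_integrable.
  - by move=> y Ey; rewrite normrM ler_wpM2r// uE.
have h2 : \int[mu]_(t in D `\` E) `|u t * k (x, t)| <=
    M * \int[mu]_(t in D `\` E) `|k (x, t)|.
  rewrite -RintegralZl//; last exact: norm_kernel_integrable.
  apply: le_Rintegral => //.
  - exact: integrableS iuk'.
  - by apply: (@integrableZl _ _ _ mu _ mE' _ (fun y => (`|k (x, y)|)%:E));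
      exact: norm_kernel_integrable.
  - by move=> y [Ey _]; rewrite normrM ler_wpM2r// uM.
lra.
Qed.

Lemma kernel_op_le (u : T -> R) (M : R) x : D x -> 0 <= M ->
  measurable_fun D u -> (forall y, D y -> `|u y| <= M) -> `|kernel_op u x| <= M.
Proof.
move=> Dx M0 mfu uM.
have := @kernel_op_le_split set0 u M 0 x measurable0 (@sub0set _ _) Dx M0 mfu uM.
rewrite mul0r !subr0 => /(_ (fun _ => False_ind _)) /le_trans; apply.
by apply: ler_piMr => //; exact: k1.
Qed.

Lemma measurable_iter_kernel_op n u : measurable_fun D u ->
  measurable_fun D (iter n kernel_op u).
Proof. by move=> mfu; elim: n => //= n IH; exact: measurable_kernel_op. Qed.

Lemma iter_kernel_op_le n (u : T -> R) (M : R) x : D x -> 0 <= M ->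
  measurable_fun D u -> (forall y, D y -> `|u y| <= M) ->
  `|iter n kernel_op u x| <= M.
Proof.
move=> + M0 mfu uM; elim: n x => [|n IH] x Dx; first exact: uM.
by apply: kernel_op_le => //; exact: measurable_iter_kernel_op.
Qed.

(* Some power of the operator shrinks the sup norm, uniformly on [E]; the
   inputs are bounded on the whole of [D]. *)
Definition contracts_on (E : set T) := exists (n : nat) (c : R),
  0 < c <= 1 /\ forall (u : T -> R) (M : R), 0 <= M -> measurable_fun D u ->
    (forall y, D y -> `|u y| <= M) ->
    forall x, E x -> `|iter n kernel_op u x| <= (1 - c) * M.

Lemma contracts_on_killing (E : set T) (s : R) : E `<=` D -> 0 < s <= 1 ->
  (forall x, E x -> \int[mu]_(y in D) `|k (x, y)| <= 1 - s) -> contracts_on E.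
Proof.
move=> ED s01 ks; exists 1%N, s; split=> // u M M0 mfu uM x Ex /=.
have Dx := ED x Ex.
have := @kernel_op_le_split set0 u M 0 x measurable0 (@sub0set _ _) Dx M0 mfu uM.
rewrite mul0r !subr0 => /(_ (fun _ => False_ind _)) /le_trans; apply.
by rewrite mulrC ler_wpM2r// ks.
Qed.

Lemma contracts_on_step (E F : set T) (s : R) : measurable E -> E `<=` D ->
  F `<=` D -> 0 < s ->
  (forall x, F x -> s <= \int[mu]_(y in E) `|k (x, y)|) ->
  contracts_on E -> contracts_on F.
Proof.
move=> mE ED FD s0 ks [n [c [c01 uc]]].
have [[x0 Fx0]|F0] := pselect (F !=set0); last first.
  exists 0%N, 1; split; first by rewrite ltr01 lexx.
  by move=> u M _ _ _ x Fx; exfalso; apply: F0; exists x.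
have leED x : D x ->
    \int[mu]_(y in E) `|k (x, y)| <= \int[mu]_(y in D) `|k (x, y)|.
  move=> Dx; rewrite -(setDUK ED) Rintegral_setU//; last 3 first.
  - exact: measurableD.
  - by rewrite setDUK//; exact: norm_kernel_integrable.
  - by apply/disj_setPS => y [? []].
  by rewrite lerDl; exact: Rintegral_ge0.
have s1 : s <= 1.
  exact: le_trans (ks _ Fx0) (le_trans (leED _ (FD _ Fx0)) (k1 _ (FD _ Fx0))).
exists n.+1, (c * s); split.
  by case/andP: c01 => c0 c1; rewrite mulr_gt0//= mulr_ile1// ltW.
move=> u M M0 mfu uM x Fx; rewrite iterS.
have Dx := FD x Fx.
apply: (le_trans (@kernel_op_le_split E _ M c x mE ED Dx M0 _ _ _)).
- exact: measurable_iter_kernel_op.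
- by move=> y Dy; exact: iter_kernel_op_le.
- by move=> y Ey; exact: uc.
rewrite mulrC ler_wpM2r// lerB ?k1//.
by case/andP: c01 => c0 c1; rewrite ler_pM2l// ks.
Qed.

Lemma contracts_on_all (E : set T) : measurable E -> E `<=` D ->
  (forall x, D x -> \int[mu]_(y in D `\` E) `|k (x, y)| <= 1 / 2) ->
  contracts_on E -> contracts_on D.
Proof.
move=> mE ED ks [n [c [c01 uc]]]; exists n.+1, (c / 2); split; first lra.
move=> u M M0 mfu uM x Dx; rewrite iterS.
apply: (le_trans (@kernel_op_le_split E _ M c x mE ED Dx M0 _ _ _)).
- exact: measurable_iter_kernel_op.
- by move=> y Dy; exact: iter_kernel_op_le.
- by move=> y Ey; exact: uc.
rewrite mulrC ler_wpM2r//.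
have := k1 x Dx; have := ks x Dx.
have -> : \int[mu]_(t in D) `|k (x, t)| =
   \int[mu]_(t in E) `|k (x, t)| + \int[mu]_(t in D `\` E) `|k (x, t)|.
  rewrite -[X in \int[mu]_(_ in X) _ = _](setDUK ED) Rintegral_setU//.
  - exact: measurableD.
  - by rewrite setDUK//; exact: norm_kernel_integrable.
  - by apply/disj_setPS => y [? []].
set p := Rintegral _ E _; set q := Rintegral _ (D `\` E) _.
nra.
Qed.


Lemma contracts_on_pos (E : set T) : E `<=` D -> contracts_on E ->
  exists (n : nat) (c : R), 0 < c <= 1 /\
    forall (u : T -> R) (M : R), 0 <= M -> measurable_fun D u ->
    (forall y, D y -> `|u y| <= M) ->
    forall x, E x -> `|iter n.+1 kernel_op u x| <= (1 - c) * M.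
Proof.
move=> ED [n [c [c01 uc]]]; exists n, c; split=> // u M M0 mfu uM x Ex.
rewrite iterSr; apply: uc => //; first exact: measurable_kernel_op.
by move=> y Dy; exact: kernel_op_le.
Qed.

Lemma sum_iter_kernel_op_le : contracts_on D -> exists C : R, 0 < C /\
  forall (h : T -> R) (H : R), 0 <= H -> measurable_fun D h ->
  (forall y, D y -> `|h y| <= H) ->
  forall x m, D x -> \sum_(0 <= j < m) `|iter j kernel_op h x| <= C * H.
Proof.
move=> /(contracts_on_pos _ (@subset_refl _ D)) [n [c [c01 uc]]].
have c0 : 0 < c by case/andP: c01.
exists (n.+1%:R / c); split; first by rewrite divr_gt0.
move=> h H H0 mh hH x m Dx.
elim/ltn_ind: m h H H0 mh hH => m IH h H H0 mh hH.
have short p : (p <= n.+1)%N ->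
    \sum_(0 <= j < p) `|iter j kernel_op h x| <= n.+1%:R * H.
  move=> pn; apply: (@le_trans _ _ (\sum_(0 <= j < p) H)).
    by apply: ler_sum => j _; exact: iter_kernel_op_le.
  by rewrite sumr_const_nat subn0 -(mulr_natl H p) ler_wpM2r// ler_nat.
have [mn|nm] := leqP m n.+1.
  apply: (le_trans (short _ mn)); rewrite ler_wpM2r// ler_pdivlMr//.
  by rewrite ler_piMr// ; case/andP: c01.
rewrite (@big_cat_nat _ _ _ n.+1)//=; last exact: ltnW.
have -> : \sum_(n.+1 <= j < m) `|iter j kernel_op h x| =
    \sum_(0 <= j < m - n.+1) `|iter j kernel_op (iter n.+1 kernel_op h) x|.
  rewrite -{1}(add0n n.+1) big_addn; apply: eq_bigr => j _.
  by rewrite iterD.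
have lt : (m - n.+1 < m)%N by rewrite ltn_subrL//= (ltn_trans _ nm).
have H1 : 0 <= (1 - c) * H by rewrite mulr_ge0// subr_ge0; case/andP: c01.
have := IH _ lt (iter n.+1 kernel_op h) ((1 - c) * H) H1
  (measurable_iter_kernel_op _ _ mh) (uc h H H0 mh hH).
have := short n.+1 (leqnn _).
set p := bigop.body _ _ _; set q := bigop.body _ _ _ => hp hq.
apply: (le_trans (lerD hp hq)).
rewrite le_eqVlt; apply/orP; left; apply/eqP; field; exact: lt0r_neq0.
Qed.

Lemma kernel_op_sum (h : T -> R) (H : R) x n : D x -> 0 <= H ->
  measurable_fun D h -> (forall y, D y -> `|h y| <= H) ->
  series (fun j => iter j kernel_op h x) n.+1 =
  h x + kernel_op (fun y => series (fun j => iter j kernel_op h y) n) x.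
Proof.
move=> Dx H0 mh hH.
have iT m : mu.-integrable D (EFin \o iter m kernel_op h).
  apply: (@bounded_integrable _ _ H) => //.
    exact: measurable_iter_kernel_op.
  by move=> y Dy; exact: iter_kernel_op_le.
have iS m : mu.-integrable D
    (EFin \o (fun y => series (fun j => iter j kernel_op h y) m)).
  elim: m => [|m IH].
    rewrite [X in _.-integrable _ X](_ : _ = cst 0%E); first exact: integrable0.
    by apply/funext => y; rewrite /= /series/= big_nil.
  rewrite [X in _.-integrable _ X](_ : _ =
    ((EFin \o (fun y => series (fun j => iter j kernel_op h y) m))
      \+ (EFin \o iter m kernel_op h))%E); first exact: integrableD.
  by apply/funext => y; rewrite /= !seriesEnat /= big_nat_recr//=.
elim: n => [|n IH].
  rewrite seriesEnat/= big_nat1/= -[LHS]addr0; congr (_ + _).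
  rewrite /kernel_op; under eq_Rintegral do rewrite /series/= big_nil mul0r.
  by rewrite Rintegral_cst// mul0r.
rewrite seriesSr IH -addrA.
congr (_ + _); rewrite -kernel_opD; [|exact: Dx|exact: iS|exact: iT].
rewrite /kernel_op; apply: eq_Rintegral => y _; congr (_ * _).
by rewrite /= !seriesEnat /= big_nat_recr//=.
Qed.

Lemma kernel_op_cvg (s : nat -> T -> R) (v : T -> R) (M : R) x : D x ->
  (forall n, measurable_fun D (s n)) -> measurable_fun D v ->
  (forall n y, D y -> `|s n y| <= M) ->
  (forall y, D y -> s ^~ y @ \oo --> v y) ->
  (fun n => kernel_op (s n) x) @ \oo --> kernel_op v x.
Proof.
move=> Dx ms mv sM sv.
have mf (f : T -> R) : measurable_fun D f ->
    measurable_fun D (fun y => (f y * k (x, y))%:E).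
  by move=> m; apply/measurable_EFinP/measurable_funM => //;
    exact: measurable_kernel_section.
have iM : mu.-integrable D (EFin \o cst (M * B)).
  apply: (@bounded_integrable _ _ `|M * B|) => //.
have [] := @dominated_convergence _ _ _ mu D mD
  (fun n y => (s n y * k (x, y))%:E) (fun y => (v y * k (x, y))%:E)
  (EFin \o cst (M * B)) (fun n => mf _ (ms n)) (mf _ mv) _ iM _.
- apply/aeW => y Dy; apply/cvg_EFin; first exact: nearW.
  by apply: cvgMl; exact: sv.
- apply/aeW => y n Dy; rewrite /= lee_fin normrM ler_pM//; first exact: sM.
  exact: kB.
move=> iv _ cv; apply: fine_cvg; rewrite fineK//.
exact: integrable_fin_num.
Qed.

Lemma kernel_op_bounded_solution : contracts_on D -> exists C : R, 0 < C /\
  forall (h : T -> R) (H : R), 0 <= H -> measurable_fun D h ->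
  (forall y, D y -> `|h y| <= H) ->
  exists v : T -> R, [/\ measurable_fun D v, forall y, D y -> `|v y| <= C * H &
    forall x, D x -> v x = h x + kernel_op v x].
Proof.
move=> /sum_iter_kernel_op_le [C [C0 CS]]; exists C; split=> // h H H0 mh hH.
pose s n x := series (fun j => iter j kernel_op h x) n.
have cs x : D x -> cvgn (s ^~ x).
  move=> Dx; apply: normed_cvg; apply: nondecreasing_is_cvgn.
    by apply: nondecreasing_series => n _; rewrite ?normr_ge0.
  by exists (C * H) => _ [n _ <-]; exact: CS.
have sM n y : D y -> `|s n y| <= C * H.
  move=> Dy; rewrite /s seriesEnat/=; apply: (le_trans (ler_norm_sum _ _ _)).
  exact: CS.
have ms n : measurable_fun D (s n).
  apply: measurable_sum => j.
  exact: measurable_iter_kernel_op.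
pose v x := limn (s ^~ x).
have mv : measurable_fun D v.
  by apply: (@measurable_fun_cvg _ _ _ _ s) => // x Dx; exact: cs.
exists v; split=> //.
- move=> y Dy.
  have : `|s n y| @[n --> \oo] --> `|v y| by apply: cvg_norm; exact: cs.
  move=> /cvg_lim <- //; apply: limr_le; [by apply: is_cvg_norm; exact: cs|].
  by apply: nearW => n; exact: sM.
- move=> x Dx.
  have c1 : (fun n => h x + kernel_op (s n) x) @ \oo --> h x + kernel_op v x.
    apply: cvgD; first exact: cvg_cst.
    by apply: (@kernel_op_cvg s v (C * H)) => // y Dy; exact: cs.
  have c2 : (fun n => s n.+1 x) @ \oo --> v x.
    by have := cs x Dx; rewrite -cvg_shiftS.
  move: c1; under eq_fun do rewrite -(kernel_op_sum h H x _ Dx H0 mh hH).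
  by move=> c1; exact: (cvg_unique _ c2 c1).
Qed.

Lemma kernel_op_bounded_eq0 (v : T -> R) (M : R) : contracts_on D ->
  measurable_fun D v -> (forall y, D y -> `|v y| <= M) ->
  (forall x, D x -> v x = kernel_op v x) -> forall x, D x -> v x = 0.
Proof.
move=> [n [c [/andP[c0 c1] uc]]] mv vM vv x Dx.
have M0 : 0 <= M by exact: le_trans (vM x Dx).
have vn m y : D y -> iter m kernel_op v y = v y.
  elim: m y => //= m IH y Dy; rewrite [RHS]vv//.
  by apply: eq_Rintegral => z; rewrite inE => Dz; rewrite IH.
have vMi i y : D y -> `|v y| <= (1 - c) ^+ i * M.
  elim: i y => [|i IH] y Dy; first by rewrite mul1r vM.
  rewrite -(vn n y Dy) exprS -mulrA; apply: uc => //.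
  by rewrite mulr_ge0// exprn_ge0// subr_ge0.
apply/eqP; rewrite -normr_le0.
have : (fun i => (1 - c) ^+ i * M) @ \oo --> 0 * M.
  by apply: cvgMl; apply: cvg_expr; rewrite ger0_norm ?subr_ge0// gtrBl.
rewrite mul0r => cv; rewrite -(cvg_lim _ cv)//.
apply: limr_ge; first exact: (cvgP _ cv).
by apply: nearW => i; exact: vMi.
Qed.

Lemma kernel_op_norm_le (w : T -> R) y : mu.-integrable D (EFin \o w) -> D y ->
  `|kernel_op w y| <= B * \int[mu]_(z in D) `|w z|.
Proof.
move=> iw Dy; have iwk := integrable_mul_kernel w y Dy iw.
apply: (le_trans (le_normr_Rintegral mD iwk)).
have iw' : mu.-integrable D (EFin \o (fun z => `|w z|)).
  exact: integrable_norm.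
rewrite -RintegralZl//; apply: le_Rintegral => //.
- exact: integrable_norm.
- exact: (@integrableZl _ _ _ mu D mD B (fun z => (`|w z|)%:E)).
- by move=> z Dz; rewrite normrM mulrC ler_wpM2r// kB.
Qed.

Lemma kernel_op_ae_eq0 (w : T -> R) : contracts_on D ->
  mu.-integrable D (EFin \o w) -> ae_eq mu D w (kernel_op w) ->
  ae_eq mu D w (cst 0).
Proof.
move=> cD iw ww.
have mw : measurable_fun D w.
  by apply/measurable_EFinP; exact: measurable_int iw.
have kwM y : D y -> `|kernel_op w y| <= B * \int[mu]_(z in D) `|w z|.
  exact: kernel_op_norm_le.
have kw0 := kernel_op_bounded_eq0 (kernel_op w) _ cD
  (measurable_kernel_op D w mw) kwM.
have kww x : D x -> kernel_op w x = kernel_op (kernel_op w) x.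
  by move=> Dx; apply: kernel_op_ae => //; exact: measurable_kernel_op.
by apply: filterS ww => y wy Dy; rewrite wy//; exact: kw0.
Qed.

Lemma kernel_op_solution : mu D = 1%E -> 0 <= B -> contracts_on D ->
  exists C : R, 0 < C /\ forall g, sq_integrable g ->
    exists u, [/\ sq_integrable u, forall x, D x -> u x = g x + kernel_op u x &
      Num.sqrt (\int[mu]_(x in D) (u x ^+ 2)) <=
      C * Num.sqrt (\int[mu]_(x in D) (g x ^+ 2))].
Proof.
move=> D1 B0 /kernel_op_bounded_solution [C [C0 Csol]].
exists (2 * (1 + C * B)); split.
  by have := mulr_ge0 (ltW C0) B0; lra.
move=> g sg; set G := Num.sqrt _.
have ig := sq_integrable_integrable g sg.
have G0 : 0 <= G by exact: sqrtr_ge0.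
have Tg y : D y -> `|kernel_op g y| <= B * G.
  move=> Dy; apply: (le_trans (kernel_op_norm_le g y ig Dy)).
  by rewrite ler_wpM2l//; exact: Rintegral_norm_le_sq.
have BG0 : 0 <= B * G by exact: mulr_ge0.
have [v [mv vM vE]] := Csol _ _ BG0 (measurable_kernel_op D g sg.1) Tg.
have iv : mu.-integrable D (EFin \o v) by exact: bounded_integrable vM.
have V0 : 0 <= C * (B * G) by rewrite mulr_ge0// ltW.
have v2 x : D x -> v x ^+ 2 <= (C * (B * G)) ^+ 2.
  by move=> Dx; rewrite -(real_normK (num_real (v x))) lerXn2r ?nnegrE// vM.
have iv2 : mu.-integrable D (EFin \o (fun x => v x ^+ 2)).
  apply: (@bounded_integrable _ _ ((C * (B * G)) ^+ 2)) => //.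
    exact: measurable_funX.
  by move=> x Dx; rewrite ger0_norm ?sqr_ge0// v2.
have sv : sq_integrable v by exact: sqr_integrable_sq.
have [suv uvle] := sq_integrableD g v sg sv.
exists (g \+ v); split=> //.
  by move=> x Dx /=; rewrite kernel_opD// vE.
have hv : \int[mu]_(x in D) (v x ^+ 2) <= (C * (B * G)) ^+ 2.
  apply: (@le_trans _ _ (\int[mu]_(x in D) ((C * (B * G)) ^+ 2))).
    apply: le_Rintegral => //.
    by apply: (@bounded_integrable _ _ `|(C * (B * G)) ^+ 2|).
  by rewrite Rintegral_cst_prob.
have hg : \int[mu]_(x in D) (g x ^+ 2) = G ^+ 2.
  by rewrite sqr_sqrtr//; apply: Rintegral_ge0 => x _; exact: sqr_ge0.
have CB := mulr_ge0 (ltW C0) B0.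
have E0 : 0 <= 2 * (1 + C * B) * G.
  by apply: mulr_ge0 => //; lra.
rewrite -(ger0_norm E0) -sqrtr_sqr ler_wsqrtr//.
apply: (le_trans uvle); rewrite hg.
have -> : (2 * (1 + C * B) * G) ^+ 2 =
  (C * B) * 8 * G ^+ 2 + 2 * G ^+ 2 + 2 * (C * (B * G)) ^+ 2
   + (2 * G ^+ 2 + 2 * (C * (B * G)) ^+ 2) by ring.
have := mulr_ge0 CB (sqr_ge0 G); have := sqr_ge0 G.
have := sqr_ge0 (C * (B * G)); lra.
Qed.

End KernelOperator.

Arguments sq_integrable {d T R} mu D u.
Arguments kernel_op {d T R} mu D k u x.
Arguments contracts_on {d T R} mu D k E.

(** * Integrals over subintervals of the unit interval *)

Section IntervalIntegrals.
Context (R : realType).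
Local Notation mu := (@lebesgue_measure R).
Local Notation Om := (@Omega R).

Lemma measurable_Omega : measurable Om.
Proof. exact: measurable_itv. Qed.

Lemma lebesgue_measure_oo (z1 z2 : R) : z1 <= z2 ->
  mu (`]z1, z2[ : set R) = (z2 - z1)%:E.
Proof.
move=> z12; rewrite lebesgue_measure_itv/= lte_fin.
by move: z12; rewrite le_eqVlt => /predU1P[->|->//]; rewrite ltxx subrr.
Qed.

Lemma lebesgue_measure_Omega : mu Om = 1%E.
Proof. by rewrite lebesgue_measure_oo// subr0. Qed.

Lemma lebesgue_measure_Omega_lty : (mu Om < +oo)%E.
Proof. by rewrite lebesgue_measure_Omega ltry. Qed.

Lemma lebesgue_measure_cc_lty (p q : R) : (mu (`[p, q] : set R) < +oo)%E.
Proof.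
by rewrite lebesgue_measure_itv/=; case: ifP => _; rewrite -?EFinB ltry.
Qed.

Lemma Rintegral_Omega_cc (f : R -> R) : measurable_fun Om f ->
  \int[mu]_(y in `[0, 1]) f y = \int[mu]_(y in Om) f y.
Proof.
move=> mf; rewrite /Rintegral/= /Omega integral_itv_bndo_bndc; last first.
  exact/measurable_EFinP.
rewrite integral_itv_obnd_cbnd//.
exact/measurable_EFinP/measurable_fun_itv_bndo_bndcP.
Qed.

Lemma Rintegral_cst_oo (r z1 z2 : R) : z1 <= z2 ->
  \int[mu]_(y in `]z1, z2[) r = r * (z2 - z1).
Proof.
move=> z12; transitivity (r * fine (mu (`]z1, z2[ : set R))).
  by apply: Rintegral_cst; exact: measurable_itv.
by rewrite lebesgue_measure_oo.
Qed.

Lemma Rintegral_ge_oo (E : set R) (f : R -> R) (m z1 z2 : R) :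
  measurable E -> mu.-integrable E (EFin \o f) -> (forall y, E y -> 0 <= f y) ->
  z1 <= z2 -> `]z1, z2[ `<=` E -> (forall y, z1 < y < z2 -> m <= f y) ->
  m * (z2 - z1) <= \int[mu]_(y in E) f y.
Proof.
move=> mE iF f0 z12 zE mf; rewrite -(setDUK zE).
have mI : measurable (`]z1, z2[ : set R) by exact: measurable_itv.
rewrite Rintegral_setU//; last 3 first.
- exact: measurableD.
- by rewrite setDUK.
- by apply/disj_setPS => y [? []].
rewrite -Rintegral_cst_oo// -[leLHS]addr0; apply: lerD.
- apply: le_Rintegral => //.
  + have Iy : (mu (`]z1, z2[ : set R) < +oo)%E.
      by rewrite lebesgue_measure_oo// ltry.
    exact: (@bounded_integrable _ _ R mu _ mI Iy _ (cst m) `|m|).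
  + exact: (@integrableS _ _ R mu E _ (EFin \o f) mE mI zE iF).
- by apply: Rintegral_ge0 => y [Ey _]; exact: f0.
Qed.

Lemma Rintegral_Omega_indic (z1 z2 : R) : 0 <= z1 -> z1 <= z2 -> z2 < 1 ->
  \int[mu]_(y in Om) \1_(`]z1, z2]) y = z2 - z1.
Proof.
move=> z10 z12 z21; rewrite /Rintegral integral_indic//; last exact: measurable_Omega.
have -> : `]z1, z2]%classic `&` Om = `]z1, z2]%classic.
  apply/setIidPl => y; rewrite /Omega /= !in_itv/= => /andP[h1 h2].
  by apply/andP; split; lra.
have mI : mu (`]z1, z2] : set R) = (z2 - z1)%:E.
  rewrite lebesgue_measure_itv/= lte_fin.
  by move: z12; rewrite le_eqVlt => /predU1P[->|->//]; rewrite ltxx subrr.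
exact: (congr1 fine mI).
Qed.

Lemma Rintegral_affine (c e p q : R) : p < q ->
  \int[mu]_(y in `[p, q]) (c + e * y) =
  c * (q - p) + e * (q ^+ 2 - p ^+ 2) / 2.
Proof.
move=> pq; pose F (y : R) := c * y + e / 2 * y ^+ 2.
have dF (y : R) : is_derive y 1 F (c + e * y).
  apply: is_derive_eq; rewrite /GRing.scale/=; lra.
have cF : continuous F.
  by move=> y; apply/differentiable_continuous/derivable1_diffP.
rewrite /Rintegral (@continuous_FTC2 _ _ F)//=.
- by rewrite /F; lra.
- apply: continuous_subspaceT => y; apply: cvgD; first exact: cvg_cst.
  by apply: cvgM; [exact: cvg_cst|exact: cvg_id].
- split=> //; first by apply: cvg_at_right_filter; exact: cF.
  by apply: cvg_at_left_filter; exact: cF.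
- by move=> y _; rewrite derive1E; exact: derive_val.
Qed.

End IntervalIntegrals.

(** * The kernel of the nonlocal Dirichlet operator *)

Section NonlocalKernel.
Context (R : realType) (w : R -> R) (delta : R).
Hypothesis wA1 : A1 w.
Hypothesis delta_itv : 0 < delta < 1 / 2.
Local Notation mu := (@lebesgue_measure R).
Local Notation Om := (@Omega R).

Let d0 : 0 < delta. Proof. by case/andP: delta_itv. Qed.
Let d2 : delta < 1 / 2. Proof. by case/andP: delta_itv. Qed.

Definition phi (r : R) : R := delta ^- 3 * w (r / delta).

Let id3 : 0 < delta ^- 3. Proof. by rewrite invr_gt0 exprn_gt0. Qed.

Lemma phi_ge0 r : 0 <= r -> 0 <= phi r.
Proof.
move=> r0; rewrite /phi mulr_ge0 ?(ltW id3)//.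
by case: wA1 => + _; apply; rewrite divr_ge0// ltW.
Qed.

Lemma phi_out r : delta <= r -> phi r = 0.
Proof.
case: wA1 => _ [_ [_ [_ [w1 _]]]] dr.
by rewrite /phi w1 ?mulr0// ler_pdivlMr// mul1r.
Qed.

Lemma phi_le r s : 0 <= r -> r <= s -> phi s <= phi r.
Proof.
move=> r0 rs; have [ds|sd] := leP delta s.
  by rewrite (phi_out s ds) phi_ge0.
case: wA1 => _ [_ [wn _]]; rewrite /phi ler_pM2l//; apply: wn.
- by rewrite divr_ge0// ltW.
- by rewrite ler_pM2r ?invr_gt0.
- by rewrite ltr_pdivrMr// mul1r.
Qed.

Lemma phi_gt0 r : 0 <= r < delta -> 0 < phi r.
Proof.
case/andP=> r0 rd; have h : 0 < phi ((r + delta) / 2).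
  rewrite /phi mulr_gt0//; case: wA1 => _ [_ [_ [wp _]]]; apply: wp.
  rewrite divr_gt0//=; last lra.
  by rewrite ltr_pdivrMr//; lra.
by apply: (lt_le_trans h); apply: phi_le => //; lra.
Qed.

Lemma w_dE x y : w_d w delta x y = phi `|x - y|. Proof. by []. Qed.

Lemma phi_le0 r : 0 <= r -> phi r <= phi 0.
Proof. by move=> r0; exact: phi_le. Qed.

Lemma measurable_phi_norm : measurable_fun [set: R] (fun r => phi `|r|).
Proof.
have -> : (fun r => phi `|r|) = (fun r => phi (Num.max r 0)) \o (Num.norm : R -> R).
  by apply/funext => r /=; congr phi; rewrite max_l.
apply: measurableT_comp => //; apply: nonincreasing_measurable => // r s rs.
by apply: phi_le; [rewrite le_max lexx orbT|rewrite ge_max !le_max rs lexx orbT].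
Qed.

Lemma measurable_w_d : measurable_fun [set: R * R] (fun z => w_d w delta z.1 z.2).
Proof.
apply: (measurableT_comp measurable_phi_norm).
by apply: measurable_funB; [exact: measurable_fst|exact: measurable_snd].
Qed.

Lemma measurable_w_d_section E x : measurable_fun E (w_d w delta x).
Proof.
apply: (@measurable_funTS _ _ _ _ E).
exact: (measurableT_comp measurable_w_d (pair1_measurable x)).
Qed.

Lemma w_d_ge0 x y : 0 <= w_d w delta x y.
Proof. by rewrite w_dE phi_ge0. Qed.

Lemma w_d_le x y : w_d w delta x y <= phi 0.
Proof. by rewrite w_dE phi_le. Qed.

Lemma measurable_invr_ge0 d (T : measurableType d) (f : T -> R) :
  measurable_fun [set: T] f -> (forall x, 0 <= f x) ->
  measurable_fun [set: T] (fun x => (f x)^-1).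
Proof.
move=> mf f0.
have -> : (fun x => (f x)^-1) = (fun y => powR y (-1)) \o f.
  by apply/funext => x /=; rewrite powR_inv1.
by apply: measurableT_comp => //; exact: measurable_powR.
Qed.

Local Notation a := (a_d w delta).
Local Notation b := (b_d w delta).

Lemma a_dE x : a x = \int[mu]_(y in Om) w_d w delta x y.
Proof. by rewrite /a_d Rintegral_Omega_cc//; exact: measurable_w_d_section. Qed.

Lemma w_d_integrable (E : set R) x : measurable E -> E `<=` Om ->
  mu.-integrable E (EFin \o w_d w delta x).
Proof.
move=> mE EO; apply: (@bounded_integrable _ _ R mu _ (measurable_Omega R)
  (lebesgue_measure_Omega_lty R) E _ (phi 0) mE EO) => //.
  exact: measurable_w_d_section.
by move=> y _; rewrite ger0_norm ?w_d_ge0// w_d_le.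
Qed.

Lemma a_d_ge (x : R) : 0 < x < 1 -> phi (delta / 2) * (delta / 2) <= a x.
Proof.
have [dp dh] := (d0, d2).
move=> /andP[x0 x1]; rewrite a_dE.
have H z : 0 <= z -> z + delta / 2 <= 1 ->
    (forall y, z < y < z + delta / 2 -> `|x - y| <= delta / 2) ->
    phi (delta / 2) * (delta / 2) <= \int[mu]_(y in Om) w_d w delta x y.
  move=> z0 z1 zy.
  have -> : phi (delta / 2) * (delta / 2) =
    phi (delta / 2) * ((z + delta / 2) - z) by lra.
  apply: Rintegral_ge_oo.
  - exact: measurable_Omega.
  - by apply: w_d_integrable => //; exact: measurable_Omega.
  - by move=> y _; exact: w_d_ge0.
  - lra.
  - move=> y; rewrite /Omega /= !in_itv/= => /andP[h1 h2].
    by apply/andP; split; lra.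
  - by move=> y hy; rewrite w_dE phi_le// zy.
have [x2|x2] := leP x (1 / 2).
  apply: (H x); [lra|lra|move=> y hy; rewrite ler_norml; lra].
by apply: (H (x - delta / 2)); [lra|lra|move=> y hy; rewrite ler_norml; lra].
Qed.

Lemma a_d_le x : a x <= phi 0.
Proof.
rewrite a_dE -[leRHS](@Rintegral_cst_prob _ _ R mu _ (measurable_Omega R) _
  (lebesgue_measure_Omega R)).
apply: le_Rintegral.
- exact: measurable_Omega.
- by apply: w_d_integrable => //; exact: measurable_Omega.
- apply: (@bounded_integrable _ _ R mu _ (measurable_Omega R)
  (lebesgue_measure_Omega_lty R) Om (cst (phi 0)) `|phi 0|) => //.
  exact: measurable_Omega.
- by move=> y _; exact: w_d_le.
Qed.

Lemma a_d_ge0 x : 0 <= a x.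
Proof. by rewrite a_dE; apply: Rintegral_ge0 => y _; exact: w_d_ge0. Qed.

Lemma measurable_a_d : measurable_fun [set: R] a.
Proof.
have -> : a = fun x => \int[mu]_y (w_d w delta x y * \1_Om y).
  apply/funext => x; rewrite a_dE Rintegral_mkcond; apply: eq_Rintegral => y _.
  by rewrite patchE indicE; case: ifPn => _; rewrite ?mulr1 ?mulr0.
apply: (@measurable_Rintegral_section _ _ R mu
  (fun z => w_d w delta z.1 z.2 * \1_Om z.2)).
apply: measurable_funM; first exact: measurable_w_d.
exact: (measurableT_comp (measurable_indic (measurable_Omega R)) measurable_snd).
Qed.

Lemma moment_integrable (x : R) (h : R -> R) (p q M : R) :
  measurable_fun [set: R] h -> p <= q ->
  (forall y, p <= y <= q -> `|h y| <= M) ->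
  mu.-integrable `[p, q] (EFin \o (fun y => h y * w_d w delta x y)).
Proof.
move=> mh pq hM.
have mI : measurable (`[p, q] : set R) by exact: measurable_itv.
have Iy := lebesgue_measure_cc_lty R (p) (q).
apply: (@bounded_integrable _ _ R mu _ mI Iy _ _ (M * phi 0)) => //.
  apply: measurable_funM; last exact: measurable_w_d_section.
  exact: measurable_funTS.
move=> y; rewrite /= in_itv/= => hy.
by rewrite normrM ler_pM// ?hM// ger0_norm ?w_d_ge0// w_d_le.
Qed.

(* [x * phi x - phi x * y] is the integrand with [w_d] frozen at distance [x],
   its largest value on the part of the horizon outside the domain. *)
Lemma left_moment_le (x : R) : 0 < x < delta ->
  \int[mu]_(y in `[x - delta, 0]) ((x - y) * w_d w delta x y) <=
  phi x * ((delta ^+ 2 - x ^+ 2) / 2).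
Proof.
move=> /andP[x0 xd].
have -> : phi x * ((delta ^+ 2 - x ^+ 2) / 2) =
    \int[mu]_(y in `[x - delta, 0]) (x * phi x + (- phi x) * y).
  by rewrite Rintegral_affine; [field|lra].
have mI : measurable (`[x - delta, 0] : set R) by exact: measurable_itv.
have Iy := lebesgue_measure_cc_lty R (x - delta) (0).
apply: le_Rintegral => //.
- apply: (@moment_integrable x (fun y => x - y) _ _ delta).
  + by apply: measurable_funB => //; exact: measurable_id.
  + lra.
  + by move=> y hy; rewrite ler_norml; lra.
- apply: (@bounded_integrable _ _ R mu _ mI Iy _ _ (phi x * delta)) => //.
    apply: measurable_funD => //; apply: measurable_funM => //.
  move=> y; rewrite /= in_itv/= => hy.
  have -> : x * phi x + - phi x * y = phi x * (x - y) by ring.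
  have p0 := phi_ge0 x (ltW x0).
  by rewrite normrM (ger0_norm p0) ler_wpM2l// ler_norml; lra.
- move=> y /=; rewrite in_itv/= => hy.
  have -> : x * phi x + - phi x * y = (x - y) * phi x by ring.
  rewrite w_dE; apply: ler_wpM2l; first lra.
  by rewrite ger0_norm; [apply: phi_le; lra|lra].
Qed.

Lemma right_moment_le (x : R) : 1 - delta < x < 1 ->
  \int[mu]_(y in `[1, x + delta]) ((y - x) * w_d w delta x y) <=
  phi (1 - x) * ((delta ^+ 2 - (1 - x) ^+ 2) / 2).
Proof.
move=> /andP[x0 xd].
have -> : phi (1 - x) * ((delta ^+ 2 - (1 - x) ^+ 2) / 2) =
    \int[mu]_(y in `[1, x + delta]) (- x * phi (1 - x) + phi (1 - x) * y).
  by rewrite Rintegral_affine; [field|lra].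
have mI : measurable (`[1, x + delta] : set R) by exact: measurable_itv.
have Iy := lebesgue_measure_cc_lty R (1) (x + delta).
apply: le_Rintegral => //.
- apply: (@moment_integrable x (fun y => y - x) _ _ delta).
  + by apply: measurable_funB => //; exact: measurable_id.
  + lra.
  + by move=> y hy; rewrite ler_norml; lra.
- apply: (@bounded_integrable _ _ R mu _ mI Iy _ _ (phi (1 - x) * delta)) => //.
    apply: measurable_funD => //; apply: measurable_funM => //.
  move=> y; rewrite /= in_itv/= => hy.
  have -> : - x * phi (1 - x) + phi (1 - x) * y = phi (1 - x) * (y - x) by ring.
  have p0 : 0 <= phi (1 - x) by apply: phi_ge0; lra.
  by rewrite normrM (ger0_norm p0) ler_wpM2l// ler_norml; lra.
- move=> y /=; rewrite in_itv/= => hy.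
  have -> : - x * phi (1 - x) + phi (1 - x) * y = (y - x) * phi (1 - x) by ring.
  rewrite w_dE; apply: ler_wpM2l; first lra.
  by rewrite ler0_norm; [apply: phi_le; lra|lra].
Qed.

Lemma moment_ratio_le (M s e : R) : 0 < e -> e <= s -> s < delta ->
  M <= phi s * ((delta ^+ 2 - s ^+ 2) / 2) ->
  2 / (s + delta) ^+ 2 * M <= phi e * ((delta - e) / (delta + e)).
Proof.
move=> e0 es sd HM; have dp := d0.
have p : 0 < 2 / (s + delta) ^+ 2 by rewrite divr_gt0// exprn_gt0//; lra.
apply: (@le_trans _ _ (2 / (s + delta) ^+ 2 *
  (phi s * ((delta ^+ 2 - s ^+ 2) / 2)))); first by rewrite ler_pM2l.
have -> : 2 / (s + delta) ^+ 2 * (phi s * ((delta ^+ 2 - s ^+ 2) / 2)) =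
  phi s * ((delta - s) / (delta + s)) by field; lra.
apply: ler_pM.
- by apply: phi_ge0; lra.
- by rewrite divr_ge0//; lra.
- by apply: phi_le; lra.
- have h1 : 0 < delta + s by lra.
  have h2 : 0 < delta + e by lra.
  rewrite ler_pdivrMr// mulrAC ler_pdivlMr//.
  have : 0 <= delta * (s - e) by apply: mulr_ge0; lra.
  lra.
Qed.

Lemma b_d_ge0 (x : R) : 0 <= b x.
Proof.
have dp := d0; rewrite /b_d; case: ifPn => [/andP[x0 xd]|_].
  apply: mulr_ge0; first by rewrite divr_ge0// sqr_ge0.
  apply: Rintegral_ge0 => y /=; rewrite in_itv/= => /andP[_ y0].
  by apply: mulr_ge0; [lra|exact: w_d_ge0].
case: ifPn => [/andP[x0 xd]|_//].
apply: mulr_ge0; first by rewrite divr_ge0// sqr_ge0.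
apply: Rintegral_ge0 => y /=; rewrite in_itv/= => /andP[y1 _].
by apply: mulr_ge0; [lra|exact: w_d_ge0].
Qed.

(* The factor (delta - e)/(delta + e) < 1 is what keeps the kernel positive at
   distance at most [e], although it may change sign farther away. *)
Lemma b_d_le (x e : R) : 0 < e -> e <= x -> e <= 1 - x -> e < delta ->
  b x <= phi e * ((delta - e) / (delta + e)).
Proof.
move=> e0 ex e1 ed; have dp := d0.
rewrite /b_d; case: ifPn => [xx|_].
  by apply: moment_ratio_le; [lra|lra|lra|exact: left_moment_le].
case: ifPn => [xx|_].
  by apply: moment_ratio_le; [lra|lra|lra|exact: right_moment_le].
by apply: mulr_ge0; [apply: phi_ge0; lra|rewrite divr_ge0//; lra].
Qed.

Lemma b_d_le_phi0 (x : R) : 0 < x < 1 -> b x <= phi 0.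
Proof.
move=> /andP[x0 x1]; have dp := d0.
pose e := Num.min (Num.min x (1 - x)) (delta / 2).
have [e0 ex e1 ed] : [/\ 0 < e, e <= x, e <= 1 - x & e < delta].
  rewrite /e; split.
  - by rewrite !lt_min; apply/andP; split; [apply/andP; split|]; lra.
  - by rewrite !ge_min lexx.
  - by rewrite !ge_min lexx orbT.
  - by rewrite !gt_min; apply/orP; right; lra.
apply: (le_trans (b_d_le x e e0 ex e1 ed)).
apply: (@le_trans _ _ (phi e * 1)).
  apply: ler_wpM2l; first by apply: phi_ge0; lra.
  by rewrite ler_pdivrMr; lra.
by rewrite mulr1 phi_le0// ltW.
Qed.

Lemma b_d_ge (x : R) : delta / 2 <= x <= 3 / 4 * delta ->
  phi (7 / 8 * delta) * 3 / 64 <= b x.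
Proof.
move=> xx; have dp := d0.
have mI : measurable (`[x - delta, 0] : set R) by exact: measurable_itv.
have p0 : 0 <= phi (7 / 8 * delta) by apply: phi_ge0; lra.
rewrite /b_d ifT; last by apply/andP; split; lra.
have h : (3 / 4 * delta * phi (7 / 8 * delta)) *
    ((x - 3 / 4 * delta) - (x - 7 / 8 * delta)) <=
    \int[mu]_(y in `[x - delta, 0]) ((x - y) * w_d w delta x y).
  apply: Rintegral_ge_oo => //.
  - apply: (@moment_integrable x (fun y => x - y) _ _ delta).
    + by apply: measurable_funB => //; exact: measurable_id.
    + lra.
    + by move=> y hy; rewrite ler_norml; lra.
  - move=> y /=; rewrite in_itv/= => hy.
    by apply: mulr_ge0; [lra|exact: w_d_ge0].
  - lra.
  - by move=> y /=; rewrite !in_itv/= => hy; apply/andP; split; lra.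
  - move=> y hy; apply: ler_pM => //; [lra|lra|].
    rewrite w_dE; apply: phi_le => //.
    by rewrite ger0_norm; lra.
apply: (@le_trans _ _ (2 / (x + delta) ^+ 2 *
  ((3 / 4 * delta * phi (7 / 8 * delta)) *
    ((x - 3 / 4 * delta) - (x - 7 / 8 * delta))))); last first.
  by apply: ler_wpM2l => //; rewrite divr_ge0// sqr_ge0.
rewrite [leRHS](_ : _ = phi (7 / 8 * delta) *
  ((3 / 16 * delta ^+ 2) / (x + delta) ^+ 2)); last by field; lra.
rewrite -mulrA; apply: ler_wpM2l => //.
have xd : 0 < (x + delta) ^+ 2 by rewrite exprn_gt0//; lra.
by rewrite ler_pdivlMr//; nra.
Qed.

Lemma measurable_b_d : measurable_fun [set: R] b.
Proof.
have dp := d0; have dh := d2.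
pose A := (`]0, delta[%classic : set R); pose E := (`]1 - delta, 1[%classic : set R).
pose l z : R := (z.1 - z.2) * w_d w delta z.1 z.2 * \1_(`]-oo, 0]) z.2.
pose r z : R := (z.2 - z.1) * w_d w delta z.1 z.2 * \1_(`[1, +oo[) z.2.
have -> : b = fun x =>
    \1_A x * (2 * ((x + delta) ^+ 2)^-1 * \int[mu]_y l (x, y)) +
    \1_E x * (2 * ((1 - x + delta) ^+ 2)^-1 * \int[mu]_y r (x, y)).
  apply/funext => x; rewrite /b_d !indicE.
  have -> : (x \in A) = (0 < x) && (x < delta).
    by rewrite /A; apply/idP/idP; rewrite inE /= in_itv.
  have -> : (x \in E) = (1 - delta < x) && (x < 1).
    by rewrite /E; apply/idP/idP; rewrite inE /= in_itv.
  case: ifPn => [xA|_].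
    rewrite (_ : (_ && _) = false) ?mul1r ?mul0r ?addr0; last first.
      by apply/negbTE/negP; lra.
    congr (_ * _); rewrite Rintegral_mkcond; apply: eq_Rintegral => y _.
    rewrite patchE /l /= indicE.
    have [y0|y0] := boolP (y \in `]-oo, 0%R]%classic); last first.
      rewrite mulr0; case: ifPn => //; rewrite inE /= in_itv/= => /andP[_ h].
      by move: y0; rewrite notin_setE /= in_itv/= h.
    rewrite mulr1; case: ifPn => // h.
    move: y0; rewrite inE/= in_itv/= => y0.
    move: h; rewrite notin_setE/= in_itv/= y0 andbT => /negP; rewrite -ltNge => h.
    by rewrite w_dE phi_out ?mulr0// ger0_norm; lra.
  rewrite mul0r add0r; case: ifPn => [xE|_]; last by rewrite mul0r.
  rewrite mul1r; congr (_ * _); rewrite Rintegral_mkcond.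
  apply: eq_Rintegral => y _; rewrite patchE /r /= indicE.
  have [y0|y0] := boolP (y \in `[1%R, +oo[%classic); last first.
    rewrite mulr0; case: ifPn => //; rewrite inE /= in_itv/= => /andP[h _].
    by move: y0; rewrite notin_setE /= in_itv/= h.
  rewrite mulr1; case: ifPn => // h.
  move: y0; rewrite inE/= in_itv/= andbT => y0.
  move: h; rewrite notin_setE/= in_itv/= y0 /= => /negP; rewrite -ltNge => h.
  by rewrite w_dE phi_out ?mulr0// ler0_norm; lra.
have mind (S : set R) : measurable S -> measurable_fun [set: R * R] (fun z => \1_S z.2 : R).
  by move=> mS; exact: (measurableT_comp (measurable_indic mS) measurable_snd).
have ml : measurable_fun [set: R * R] l.
  apply: measurable_funM; last by apply: mind; exact: measurable_itv.
  apply: measurable_funM; last exact: measurable_w_d.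
  by apply: measurable_funB; [exact: measurable_fst|exact: measurable_snd].
have mr : measurable_fun [set: R * R] r.
  apply: measurable_funM; last by apply: mind; exact: measurable_itv.
  apply: measurable_funM; last exact: measurable_w_d.
  by apply: measurable_funB; [exact: measurable_snd|exact: measurable_fst].
apply: measurable_funD; apply: measurable_funM.
- by apply: measurable_indic; exact: measurable_itv.
- apply: measurable_funM; last exact: (@measurable_Rintegral_section _ _ R mu l ml).
  apply: measurable_funM => //; apply: measurable_invr_ge0 => [|x].
    by apply: measurable_funX; apply: measurable_funD => //; exact: measurable_id.
  exact: sqr_ge0.
- by apply: measurable_indic; exact: measurable_itv.
- apply: measurable_funM; last exact: (@measurable_Rintegral_section _ _ R mu r mr).
  apply: measurable_funM => //; apply: measurable_invr_ge0 => [|x].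
    by apply: measurable_funX; apply: measurable_funD => //; apply: measurable_funB.
  exact: sqr_ge0.
Qed.

Lemma chiE (S : set R) : chi S = \1_S.
Proof.
apply/funext => r; rewrite /chi indicE.
by have [rS|rS] := boolP `[< S r >]; rewrite /in_mem/= /in_set ?rS ?(negbTE rS).
Qed.

Definition nonlocal_kernel (z : R * R) : R :=
  w_d w delta z.1 z.2 - b z.1 * chi `[0, delta] `|z.2 - z.1|.
Local Notation K := nonlocal_kernel.

Lemma measurable_nonlocal_kernel : measurable_fun [set: R * R] K.
Proof.
apply: measurable_funB; first exact: measurable_w_d.
apply: measurable_funM.
  exact: (measurableT_comp measurable_b_d measurable_fst).
rewrite chiE; have mS : measurable (`[0, delta] : set R) by exact: measurable_itv.
apply: (measurableT_comp (measurable_indic mS)).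
apply: (@measurableT_comp _ _ _ _ _ _ (Num.norm : R -> R)) => //.
by apply: measurable_funB; [exact: measurable_snd|exact: measurable_fst].
Qed.

Lemma nonlocal_kernel_in x y : `|y - x| <= delta ->
  K (x, y) = w_d w delta x y - b x.
Proof.
move=> xy; rewrite /K /chi /= asboolT ?mulr1//= in_itv/= xy andbT.
exact: normr_ge0.
Qed.

Lemma nonlocal_kernel_out x y : delta < `|y - x| -> K (x, y) = 0.
Proof.
move=> xy; rewrite /K /chi /= asboolF ?mulr0 ?subr0.
  by rewrite w_dE distrC phi_out// ltW.
by rewrite /= in_itv/= normr_ge0/= leNgt xy.
Qed.

Lemma nonlocal_kernel_le (x y : R) : 0 < x < 1 -> `|K (x, y)| <= phi 0.
Proof.
move=> x01; have bl := b_d_le_phi0 x x01; have b0 := b_d_ge0 x.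
have wl := w_d_le x y; have w0 := w_d_ge0 x y.
have [xy|xy] := leP `|y - x| delta.
  by rewrite nonlocal_kernel_in// ler_norml; lra.
by rewrite nonlocal_kernel_out// normr0; exact: phi_ge0.
Qed.

Lemma nonlocal_kernel_ge (x y e : R) : 0 < e -> e <= x -> e <= 1 - x ->
  e < delta -> `|y - x| <= e ->
  phi e * (2 * e / (delta + e)) <= K (x, y).
Proof.
move=> e0 ex e1 ed yx; have dp := d0.
rewrite nonlocal_kernel_in; last by rewrite (le_trans yx)// ltW.
have wy : phi e <= w_d w delta x y by rewrite w_dE distrC; exact: phi_le.
have bx := b_d_le x e e0 ex e1 ed.
have -> : phi e * (2 * e / (delta + e)) =
  phi e - phi e * ((delta - e) / (delta + e)) by field; lra.
lra.
Qed.

Lemma nonlocal_kernel_integrable (S : set R) x : 0 < x < 1 ->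
  measurable S -> S `<=` Om ->
  mu.-integrable S (EFin \o (fun y => `|K (x, y)|)).
Proof.
move=> x01 mS SO; apply: (@bounded_integrable _ _ R mu _ (measurable_Omega R)
  (lebesgue_measure_Omega_lty R) S _ (phi 0) mS SO) => //.
  apply: measurable_funTS; apply: (measurableT_comp (@normr_measurable R setT)).
  exact: (measurableT_comp measurable_nonlocal_kernel (pair1_measurable x)).
by move=> y _; rewrite normr_id; exact: nonlocal_kernel_le.
Qed.

(* |K| <= w_delta - b 1_]0, x+delta] + 2 b 1_]2x, x+delta], since K >= 0 at
   distance at most x and K >= - b everywhere; the right-hand side integrates
   to a - b (3x - delta). *)
Lemma Rintegral_nonlocal_kernel_killing (x : R) :
  delta / 2 <= x <= 3 / 4 * delta ->
  \int[mu]_(y in Om) `|K (x, y)| <= a x - b x * (delta / 2).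
Proof.
move=> xd; have dp := d0; have dh := d2.
have x01 : 0 < x < 1 by lra.
have b0 := b_d_ge0 x.
have iw : mu.-integrable Om (EFin \o w_d w delta x).
  by apply: w_d_integrable => //; exact: measurable_Omega.
have iI (c z1 z2 : R) : mu.-integrable Om (EFin \o (fun y => c * \1_(`]z1, z2]) y)).
  apply: (@bounded_integrable _ _ R mu _ (measurable_Omega R)
    (lebesgue_measure_Omega_lty R) Om _ `|c| (measurable_Omega R)) => //.
    apply: measurable_funM => //; apply: measurable_indic; exact: measurable_itv.
  move=> y _; rewrite normrM indicE; case: (_ \in _); rewrite ?normr1 ?mulr1//.
  by rewrite normr0 mulr0.
have iI1 (z1 z2 : R) : mu.-integrable Om (EFin \o (fun y => \1_(`]z1, z2]) y : R)).
  have := iI 1 z1 z2; apply: eq_integrable; first exact: measurable_Omega.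
  by move=> y _ /=; rewrite mul1r.
have i1 := iI (- b x) 0 (x + delta); have i2 := iI (2 * b x) (2 * x) (x + delta).
have mO := measurable_Omega R.
have i12 : mu.-integrable Om (EFin \o (fun y => - b x * \1_(`]0, x + delta]) y
     + 2 * b x * \1_(`]2 * x, x + delta]) y)).
  exact: (@integrableD _ _ R mu Om mO _ _ i1 i2).
have h : \int[mu]_(y in Om) `|K (x, y)| <=
  \int[mu]_(y in Om) (w_d w delta x y + (- b x * \1_(`]0, x + delta]) y
     + 2 * b x * \1_(`]2 * x, x + delta]) y)).
  apply: le_Rintegral.
  - exact: measurable_Omega.
  - by apply: nonlocal_kernel_integrable => //; exact: measurable_Omega.
  - exact: (@integrableD _ _ R mu Om mO _ _ iw i12).
  move=> y; rewrite /Omega /= in_itv/= => /andP[y0 y1].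
  have w0 := w_d_ge0 x y.
  rewrite !indicE; have [yx|yx] := leP y (x + delta); last first.
    rewrite nonlocal_kernel_out; last by rewrite ger0_norm; lra.
    rewrite normr0 !memNset ?mulr0 ?addr0//=; rewrite in_itv/=; apply/negP; lra.
  rewrite nonlocal_kernel_in; last by rewrite ler_norml; lra.
  rewrite (mem_set (_ : `]0, x + delta]%classic y)); last first.
    by rewrite /= in_itv/= yx y0.
  have [y2|y2] := leP y (2 * x).
    rewrite memNset ?mulr0 ?addr0; last first.
      by rewrite /= in_itv/= => /andP[]; rewrite ltNge y2.
    have := nonlocal_kernel_ge x y x; rewrite nonlocal_kernel_in; last first.
      by rewrite ler_norml; lra.
    have yx' : `|y - x| <= x by rewrite ler_norml; lra.
    have p0 : 0 <= phi x * (2 * x / (delta + x)).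
      by apply: mulr_ge0; [apply: phi_ge0; lra|apply: divr_ge0; lra].
    have [h1 h2 h3 h4] : [/\ 0 < x, x <= x, x <= 1 - x & x < delta] by split; lra.
    move=> /(_ h1 h2 h3 h4 yx') hk.
    by rewrite /= mulr1 ger0_norm; lra.
  rewrite mem_set; last by rewrite /= in_itv/= yx y2.
  by rewrite ler_norml /= !mulr1; lra.
apply: (le_trans h).
have -> : \int[mu]_(y in Om) (w_d w delta x y + (- b x * \1_(`]0, x + delta]) y
     + 2 * b x * \1_(`]2 * x, x + delta]) y)) =
  a x + (- b x * (x + delta - 0) + 2 * b x * (x + delta - 2 * x)).
  rewrite (@RintegralD _ _ R mu Om _ _ mO iw i12).
  rewrite (@RintegralD _ _ R mu Om _ _ mO i1 i2) -a_dE.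
  rewrite (@RintegralZl _ _ R mu Om _ (- b x) mO (iI1 0 (x + delta))).
  rewrite (@RintegralZl _ _ R mu Om _ (2 * b x) mO (iI1 (2 * x) (x + delta))).
  by rewrite !Rintegral_Omega_indic//; lra.
have : 0 <= b x * (2 * x - delta) + b x * (x - delta / 2).
  by apply: addr_ge0; apply: mulr_ge0 => //; lra.
lra.
Qed.

(* [K] and [wtilde_d] use closed and open indicators: they agree off the three
   points x, x - delta, x + delta. *)
Lemma Rintegral_nonlocal_kernel_le (x : R) : A2 w delta -> 0 < x < 1 ->
  \int[mu]_(y in Om) `|K (x, y)| <= a x.
Proof.
move=> hA2 x01.
have mwt : measurable_fun Om (wtilde_d w delta x).
  rewrite /wtilde_d chiE; apply: measurable_funTS.
  apply: (measurableT_comp (@normr_measurable R setT)).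
  apply: measurable_funB; first exact: measurable_w_d_section.
  apply: measurable_funM => //.
  have mS : measurable (`]0, delta[ : set R) by exact: measurable_itv.
  apply: (measurableT_comp (measurable_indic mS)).
  by apply: (measurableT_comp (@normr_measurable R setT)); exact: measurable_funB.
have -> : \int[mu]_(y in Om) `|K (x, y)| =
    \int[mu]_(y in Om) wtilde_d w delta x y.
  congr fine; apply: ae_eq_integral.
  - exact: measurable_Omega.
  - apply: measurable_int; apply: nonlocal_kernel_integrable => //.
    exact: measurable_Omega.
  - exact/measurable_EFinP.
  pose F : set R := [set x; x - delta; x + delta].
  exists F; split.
  - by apply: measurableU; [apply: measurableU|]; exact: measurable_set1.
  - by apply: countable_lebesgue_measure0; apply: finite_set_countable;
      rewrite /F !finite_setU; do ?split; exact: finite_set1.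
  move=> y /= /not_implyP[_]; apply: contra_notP => Fy.
  rewrite /K /wtilde_d /=; congr (`| _ - _ * _ |%:E).
  have v0 : `|y - x| != 0.
    by rewrite normr_eq0 subr_eq0; apply/eqP => yx; apply: Fy; left; left.
  have vd : `|y - x| != delta.
    apply/eqP => h; apply: Fy; have [yx|yx] := leP x y.
      by right; move: h; rewrite /= ger0_norm; lra.
    by left; right; move: h; rewrite /= ltr0_norm; lra.
  rewrite /chi /= !in_itv/= !le_eqVlt (negbTE vd) [0 == _]eq_sym.
  by rewrite (negbTE v0).
rewrite -Rintegral_Omega_cc//; apply: hA2.
by rewrite /Omega /= in_itv.
Qed.

Local Notation a0 := (phi (delta / 2) * (delta / 2)).

Lemma phi0_gt0 : 0 < phi 0.
Proof. by apply: phi_gt0; rewrite lexx d0. Qed.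

Lemma a_d_lower_gt0 : 0 < a0.
Proof.
have dp := d0; apply: mulr_gt0; last lra.
by apply: phi_gt0; lra.
Qed.

Lemma a_d_gt0 x : 0 < x < 1 -> 0 < a x.
Proof. by move=> x01; exact: lt_le_trans a_d_lower_gt0 (a_d_ge x x01). Qed.

Definition normalized_kernel (z : R * R) : R := K z / a z.1.
Local Notation k := normalized_kernel.
Local Notation B := (phi 0 / a0).
Let mO := measurable_Omega R.
Let Oy := lebesgue_measure_Omega_lty R.

Lemma measurable_normalized_kernel : measurable_fun [set: R * R] k.
Proof.
apply: measurable_funM; first exact: measurable_nonlocal_kernel.
apply: (measurableT_comp _ measurable_fst (f := fun x => (a x)^-1)).
by apply: measurable_invr_ge0; [exact: measurable_a_d|exact: a_d_ge0].
Qed.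

Lemma normalized_kernel_le x y : Om x -> Om y -> `|k (x, y)| <= B.
Proof.
rewrite /Omega/= in_itv/= => x01 _.
have ap := a_d_gt0 x x01.
rewrite /k normrM; apply: ler_pM => //; first exact: nonlocal_kernel_le.
rewrite normfV (gtr0_norm ap) lef_pV2 ?posrE//; first exact: a_d_ge.
exact: a_d_lower_gt0.
Qed.

Lemma Rintegral_normalized_kernel (S : set R) (x : R) : 0 < x < 1 ->
  measurable S -> S `<=` Om ->
  \int[mu]_(y in S) `|k (x, y)| = (\int[mu]_(y in S) `|K (x, y)|) / a x.
Proof.
move=> x01 mS SO; have ap := a_d_gt0 x x01.
have iK := nonlocal_kernel_integrable S x x01 mS SO.
rewrite -(@RintegralZr _ _ R mu S _ (a x)^-1 mS iK).
by apply: eq_Rintegral => y _; rewrite /k normrM normfV (gtr0_norm ap).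
Qed.

Lemma normalized_kernel_ge (x y e : R) : 0 < e -> e <= x -> e <= 1 - x ->
  e < delta -> `|y - x| <= e ->
  phi e * (2 * e / (delta + e)) / phi 0 <= `|k (x, y)|.
Proof.
move=> e0 ex e1 ed yx; have dp := d0.
have x01 : 0 < x < 1 by lra.
have ap := a_d_gt0 x x01.
have hK := nonlocal_kernel_ge x y e e0 ex e1 ed yx.
rewrite /k normrM normfV (gtr0_norm ap) /=; apply: ler_pM.
- by apply: mulr_ge0; [apply: phi_ge0; lra|apply: divr_ge0; lra].
- by rewrite invr_ge0 ltW// phi0_gt0.
- exact: le_trans hK (ler_norm _).
- by rewrite lef_pV2 ?posrE// ?phi0_gt0//; exact: a_d_le.
Qed.

Section Contraction.
Hypothesis wA2 : A2 w delta.

Lemma Rintegral_normalized_kernel_le1 x : Om x ->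
  \int[mu]_(y in Om) `|k (x, y)| <= 1.
Proof.
rewrite /Omega/= in_itv/= => x01.
rewrite Rintegral_normalized_kernel// ler_pdivrMr ?a_d_gt0// mul1r.
exact: Rintegral_nonlocal_kernel_le.
Qed.

Let mk := measurable_normalized_kernel.
Let kB := normalized_kernel_le.
Let k1 := Rintegral_normalized_kernel_le1.

Lemma contracts_on_killing_zone :
  contracts_on mu Om k `[delta / 2, 3 / 4 * delta].
Proof.
have dp := d0; have dh := d2; have p0 := phi0_gt0.
pose s := phi (7 / 8 * delta) * 3 / 64 * (delta / 2) / phi 0.
have p7 : 0 < phi (7 / 8 * delta) by apply: phi_gt0; lra.
have s0 : 0 < s by rewrite /s divr_gt0// mulr_gt0//; lra.
have ks x : delta / 2 <= x <= 3 / 4 * delta ->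
    \int[mu]_(y in Om) `|k (x, y)| <= 1 - s.
  move=> xd; have x01 : 0 < x < 1 by lra.
  have ap := a_d_gt0 x x01.
  rewrite Rintegral_normalized_kernel// ler_pdivrMr//.
  apply: (le_trans (Rintegral_nonlocal_kernel_killing x xd)).
  rewrite mulrBl mul1r lerB//.
  apply: (@le_trans _ _ (s * phi 0)).
    by rewrite ler_pM2l//; exact: a_d_le.
  rewrite /s divfK ?lt0r_neq0//; apply: ler_wpM2r; first lra.
  exact: b_d_ge.
have s1 : s <= 1.
  have : 0 <= \int[mu]_(y in Om) `|k (delta / 2, y)|.
    by apply: Rintegral_ge0 => y _; exact: normr_ge0.
  have := ks (delta / 2); have h : delta / 2 <= delta / 2 <= 3 / 4 * delta by lra.
  by move=> /(_ h); lra.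
apply: (@contracts_on_killing _ _ R mu Om mO Oy k B mk kB _ s).
- by move=> x; rewrite /Omega /= !in_itv/= => xd; lra.
- by rewrite s0.
- by move=> x; rewrite /= in_itv/=; exact: ks.
Qed.

Lemma contracts_on_enlarge (e l r l' r' : R) : 0 < e -> e < delta ->
  e <= l -> l + e / 2 <= r -> r <= 1 - e -> e <= l' -> r' <= 1 - e ->
  l - e / 2 <= l' -> r' <= r + e / 2 ->
  contracts_on mu Om k `[l, r] -> contracts_on mu Om k `[l', r'].
Proof.
move=> e0 ed el lr r1 el' r1' ll' rr'; have dp := d0; have p0 := phi0_gt0.
pose m := phi e * (2 * e / (delta + e)) / phi 0.
have m0 : 0 < m.
  rewrite /m divr_gt0// mulr_gt0//; first by apply: phi_gt0; lra.
  by apply: divr_gt0; lra.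
have mI : measurable (`[l, r] : set R) by exact: measurable_itv.
have IO : `[l, r]%classic `<=` Om.
  by move=> x; rewrite /Omega /= !in_itv/= => xd; lra.
have IO' : `[l', r']%classic `<=` Om.
  by move=> x; rewrite /Omega /= !in_itv/= => xd; lra.
apply: (@contracts_on_step _ _ R mu Om mO Oy k B mk kB k1 _ _ (m * (e / 2))) => //.
  by apply: mulr_gt0 => //; lra.
move=> x; rewrite /= in_itv/= => xd.
pose z1 := Num.max l (x - e); pose z2 := Num.min r (x + e).
have hz : z1 + e / 2 <= z2.
  by rewrite /z2 le_min /z1 -!lerBrDr !ge_max; apply/andP; split; apply/andP; split; lra.
have z1l : l <= z1 by rewrite le_max lexx.
have z1x : x - e <= z1 by rewrite le_max lexx orbT.
have z2r : z2 <= r by rewrite ge_min lexx.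
have z2x : z2 <= x + e by rewrite ge_min lexx orbT.
apply: (@le_trans _ _ (m * (z2 - z1))); first by rewrite ler_pM2l//; lra.
apply: Rintegral_ge_oo => //.
- have x01 : 0 < x < 1 by lra.
  apply: (@bounded_integrable _ _ R mu _ mO Oy _ _ B mI IO) => //.
    apply: measurable_funTS; apply: (measurableT_comp (@normr_measurable R setT)).
    exact: (measurableT_comp mk (pair1_measurable x)).
  by move=> y Iy; rewrite normr_id; apply: kB; [rewrite /Omega/= in_itv|exact: IO].
- lra.
- by move=> y; rewrite /= !in_itv/= => hy; lra.
- by move=> y hy; apply: normalized_kernel_ge; rewrite ?ler_norml; lra.
Qed.

Lemma contracts_on_inner (e : R) : 0 < e -> e <= delta / 4 ->
  contracts_on mu Om k `[e, 1 - e].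
Proof.
move=> e0 ed; have dp := d0; have dh := d2.
pose l n : R := Num.max e (delta / 2 - n%:R * (e / 2)).
pose r n : R := Num.min (1 - e) (3 / 4 * delta + n%:R * (e / 2)).
have H n : contracts_on mu Om k `[l n, r n].
  elim: n => [|n IH].
    have -> : l 0 = delta / 2 by rewrite /l mul0r subr0 max_r//; lra.
    have -> : r 0 = 3 / 4 * delta by rewrite /r mul0r addr0 min_r//; lra.
    exact: contracts_on_killing_zone.
  have n0 : 0 <= n%:R * (e / 2) by apply: mulr_ge0; [exact: ler0n|lra].
  have le : e <= l n by rewrite le_max lexx.
  have l2 : l n <= delta / 2 by rewrite ge_max; apply/andP; split; lra.
  have re : r n <= 1 - e by rewrite ge_min lexx.
  have r2 : 3 / 4 * delta <= r n by rewrite le_min; apply/andP; split; lra.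
  apply: (@contracts_on_enlarge e (l n) (r n)) => //; [lra|lra| | | |].
  - by rewrite le_max lexx.
  - by rewrite ge_min lexx.
  - rewrite /l -(natr1 n) lerBlDr ge_max; apply/andP; split.
      by rewrite -lerBlDr le_max; apply/orP; left; lra.
    by rewrite -lerBlDr le_max; apply/orP; right; lra.
  - rewrite /r -(natr1 n) -lerBlDr le_min; apply/andP; split.
      by rewrite lerBlDr ge_min; apply/orP; left; lra.
    by rewrite lerBlDr ge_min; apply/orP; right; lra.
have [N hN] : exists N : nat, 2 / e < N%:R.
  exists (Num.bound (2 / e)); apply: archi_boundP.
  by rewrite divr_ge0//; lra.
have hN1 : 1 <= N%:R * (e / 2).
  by move: hN; rewrite ltr_pdivrMr// => hN; lra.
have := H N.
have -> : l N = e by rewrite /l max_l//; lra.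
by have -> : r N = 1 - e by rewrite /r min_l//; lra.
Qed.

Lemma contracts_on_Omega : contracts_on mu Om k Om.
Proof.
have dp := d0; have dh := d2; have p0 := phi0_gt0; have ap := a_d_lower_gt0.
pose e := Num.min (delta / 4) (a0 / (4 * phi 0)).
have ap4 : 0 < a0 / (4 * phi 0) by apply: divr_gt0 => //; lra.
have e0 : 0 < e by rewrite lt_min; apply/andP; split; lra.
have e4 : e <= delta / 4 by rewrite ge_min lexx.
have ea : e <= a0 / (4 * phi 0) by rewrite ge_min lexx orbT.
have B0 : 0 <= B by rewrite divr_ge0// ltW.
have Be : B * (2 * e) <= 1 / 2.
  have -> : 1 / 2 = B * (2 * (a0 / (4 * phi 0))).
    have := lt0r_neq0 ap; move: a0 => q q0.
    by field; rewrite q0 lt0r_neq0.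
  by apply: ler_wpM2l => //; lra.
have mI : measurable (`[e, 1 - e] : set R) by exact: measurable_itv.
have IO : `[e, 1 - e]%classic `<=` Om.
  by move=> x; rewrite /Omega /= !in_itv/= => xd; lra.
have mC : measurable (Om `\` `[e, 1 - e]) by exact: measurableD.
have CO : Om `\` `[e, 1 - e] `<=` Om by move=> x [].
have iB (S : set R) : measurable S -> S `<=` Om -> mu.-integrable S (EFin \o cst B).
  by move=> mS SO; apply: (@bounded_integrable _ _ R mu _ mO Oy S _ `|B| mS SO).
apply: (@contracts_on_all _ _ R mu Om mO Oy k B mk kB k1 `[e, 1 - e]%classic) => //;
  last exact: contracts_on_inner.
move=> x Ox; apply: (@le_trans _ _ (\int[mu]_(y in Om `\` `[e, 1 - e]) B)).
  apply: le_Rintegral => //.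
  - apply: (@bounded_integrable _ _ R mu _ mO Oy _ _ B mC CO) => //.
      apply: measurable_funTS; apply: (measurableT_comp (@normr_measurable R setT)).
      exact: (measurableT_comp mk (pair1_measurable x)).
    by move=> y Iy; rewrite normr_id; apply: kB => //; exact: CO.
  - exact: iB.
  - by move=> y Iy; apply: kB => //; exact: CO.
have h1 : \int[mu]_(y in Om) B = B.
  exact: (@Rintegral_cst_prob _ _ R mu _ mO _ (lebesgue_measure_Omega R)).
have h2 : B * ((1 - e) - e) <= \int[mu]_(y in `[e, 1 - e]) B.
  apply: Rintegral_ge_oo => //; [exact: iB|lra|].
  by move=> y; rewrite /= !in_itv/= => hy; lra.
have h3 : \int[mu]_(y in Om) B = \int[mu]_(y in `[e, 1 - e]) B +
   \int[mu]_(y in Om `\` `[e, 1 - e]) B.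
  rewrite -[in LHS](setDUK IO) (@Rintegral_setU _ _ R mu _ _ _ mI mC)//.
  - by rewrite setDUK//; exact: iB.
  - by apply/disj_setPS => y [? []].
rewrite h1 in h3.
have -> : \int[mu]_(y in Om `\` `[e, 1 - e]) B = B - \int[mu]_(y in `[e, 1 - e]) B.
  by apply/eqP; rewrite eq_sym subr_eq addrC; exact/eqP.
apply: (le_trans (lerB (lexx B) h2)); clear h1 h2 h3; lra.
Qed.

End Contraction.

Lemma NtildeE (u : R -> R) x : L2 u -> Om x ->
  Ntilde w delta u x = a x * (u x - kernel_op mu Om k u x).
Proof.
move=> u2 Ox; have x01 : 0 < x < 1 by move: Ox; rewrite /Omega/= in_itv.
have ap := a_d_gt0 x x01.
have iu := @sq_integrable_integrable _ _ R mu Om mO Oy u u2.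
have iuk := @integrable_mul_kernel _ _ R mu Om mO k B
  measurable_normalized_kernel normalized_kernel_le u x Ox iu.
rewrite mulrBr /kernel_op -(@RintegralZl _ _ R mu Om _ (a x) mO iuk).
congr (_ - _); rewrite Rintegral_Omega_cc.
  apply: eq_Rintegral => y _; rewrite /k [RHS]mulrCA [a x * _]mulrC divfK//.
  exact: lt0r_neq0.
apply: measurable_funM; first exact: u2.1.
apply: measurable_funTS.
exact: (measurableT_comp measurable_nonlocal_kernel (pair1_measurable x)).
Qed.

End NonlocalKernel.

Theorem mainTheorem3 (R : realType) (w : R -> R) (delta : R) :
  A1 w -> 0 < delta < 1 / 2 -> A2 w delta ->
  (forall u, L2 u -> L2 (Ntilde w delta u)) /\
  (forall u v, L2 u -> L2 v -> eq_L2 u v ->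
     eq_L2 (Ntilde w delta u) (Ntilde w delta v)) /\
  exists C : R, 0 < C /\
    (forall f, L2 f -> exists u, L2 u /\ eq_L2 (Ntilde w delta u) f /\
                                 L2norm u <= C * L2norm f) /\
    (forall u v, L2 u -> L2 v -> eq_L2 (Ntilde w delta u) (Ntilde w delta v) ->
                 eq_L2 u v).
Proof.
move=> wA1 dd wA2.
pose mu := @lebesgue_measure R; pose Om := @Omega R.
have mO := measurable_Omega R; have Oy := lebesgue_measure_Omega_lty R.
pose k := normalized_kernel R w delta.
pose a := a_d w delta.
pose a0 := phi R w delta (delta / 2) * (delta / 2).
pose B := phi R w delta 0 / a0.
have a00 : 0 < a0 by exact: a_d_lower_gt0.
have p0 : 0 < phi R w delta 0 by exact: phi0_gt0.
have B0 : 0 <= B by rewrite divr_ge0// ltW.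
have mk : measurable_fun [set: R * R] k by exact: measurable_normalized_kernel.
have kB : forall x y, Om x -> Om y -> `|k (x, y)| <= B.
  exact: normalized_kernel_le.
have k1 : forall x, Om x -> \int[mu]_(y in Om) `|k (x, y)| <= 1.
  exact: Rintegral_normalized_kernel_le1.
have cO : contracts_on mu Om k Om by exact: contracts_on_Omega.
have O01 x : Om x -> 0 < x < 1 by rewrite /Om /Omega /= in_itv.
have ma : measurable_fun Om a by apply: measurable_funTS; exact: measurable_a_d.
have ap x : Om x -> 0 < a x by move=> /O01; exact: a_d_gt0.
have NE (u : R -> R) x : L2 u -> Om x -> Ntilde w delta u x =
    a x * (u x - kernel_op mu Om k u x) by exact: NtildeE.
have iL2 (u : R -> R) : L2 u -> mu.-integrable Om (EFin \o u).
  exact: (@sq_integrable_integrable _ _ R mu Om mO Oy).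
have L2eq (u v : R -> R) : (forall x, Om x -> u x = v x) -> L2 u -> L2 v.
  move=> uv [mfu u2]; split.
    by apply: eq_measurable_fun mfu => x; rewrite inE => Ox; rewrite uv.
  have vu2 : (\int[mu]_(x in Om) ((v x) ^+ 2)%:E =
              \int[mu]_(x in Om) ((u x) ^+ 2)%:E)%E.
    by apply: eq_integral => x; rewrite inE => Ox; rewrite uv.
  exact: (eq_ind_r (fun z => (z < +oo)%E) u2 vu2).
have L2k (u : R -> R) : L2 u -> L2 (kernel_op mu Om k u).
  move=> u2; apply: (@sq_integrable_bounded _ _ R mu Om mO Oy _
    (B * \int[mu]_(z in Om) `|u z|)).
    by apply: (@measurable_kernel_op _ _ R mu Om mO k mk); exact: u2.1.
  move=> x Ox; apply: (@kernel_op_norm_le _ _ R mu Om mO k B mk kB u x) => //.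
  exact: iL2.
have L2B (u v : R -> R) : L2 u -> L2 v -> L2 (u \- v).
  move=> u2 v2.
  have [v2' _] := @sq_integrableM _ _ R mu Om mO (cst (-1)) v 1
    (measurable_cst _) (fun x _ => eq_ind_r (fun z => z <= 1) (lexx 1) (normrN1 R)) v2.
  have [uv _] := @sq_integrableD _ _ R mu Om mO _ _ u2 v2'.
  by apply: L2eq uv => x _ /=; rewrite mulN1r.
have aM x : Om x -> `|a x| <= phi R w delta 0.
  by move=> Ox; rewrite gtr0_norm ?ap//; exact: a_d_le.
split=> [u u2|].
  have [h _] := @sq_integrableM _ _ R mu Om mO a _ (phi R w delta 0) ma aM
    (L2B _ _ u2 (L2k _ u2)).
  by apply: L2eq h => x Ox; rewrite NE.
have kae (u v : R -> R) x : L2 u -> L2 v -> eq_L2 u v ->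
    kernel_op mu Om k u x = kernel_op mu Om k v x.
  move=> u2 v2 uv; apply: (@kernel_op_ae _ _ R mu Om mO k mk) => //.
    exact: u2.1.
  exact: v2.1.
split=> [u v u2 v2 uv|].
  have := uv; apply: filterS => x uvx Ox.
  by rewrite !NE// (kae u v)// uvx.
have [C [C0 CS]] := @kernel_op_solution _ _ R mu Om mO Oy k B mk kB k1
  (lebesgue_measure_Omega R) B0 cO.
exists (C / a0); split; first by rewrite divr_gt0.
split=> [f f2|u v u2 v2 uv].
  have mia : measurable_fun Om (fun x => (a x)^-1).
    apply: measurable_funTS; apply: measurable_invr_ge0.
      exact: measurable_a_d.
    exact: a_d_ge0.
  have iaM x : Om x -> `|(a x)^-1| <= a0^-1.
    move=> Ox; rewrite gtr0_norm ?invr_gt0 ?ap//.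
    by rewrite lef_pV2 ?posrE ?ap//; apply: a_d_ge => //; exact: O01.
  have [g2 gle] := @sq_integrableM _ _ R mu Om mO _ f a0^-1 mia iaM f2.
  have [u [u2 uE ule]] := CS _ g2.
  exists u; split=> //; split.
    apply/aeW => x Ox; rewrite NE// uE// addrK mulrA divff ?mul1r//.
    exact: lt0r_neq0 (ap _ Ox).
  apply: (le_trans ule); rewrite -mulrA ler_pM2l//.
  have ia0 : 0 <= a0^-1 by rewrite invr_ge0 ltW.
  rewrite -[X in X * _](ger0_norm ia0) -sqrtr_sqr -sqrtrM ?sqr_ge0//.
  exact: ler_wsqrtr.
have d2 := L2B _ _ u2 v2.
have dae : ae_eq mu Om (u \- v) (kernel_op mu Om k (u \- v)).
  have := uv; apply: filterS => x uvx Ox.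
  have := uvx Ox; rewrite !NE// => /(mulfI (lt0r_neq0 (ap _ Ox))) h.
  rewrite (@kernel_opB _ _ R mu Om mO k B mk kB u v x Ox (iL2 _ u2) (iL2 _ v2)).
  by rewrite /=; lra.
have := @kernel_op_ae_eq0 _ _ R mu Om mO k B mk kB _ cO (iL2 _ d2) dae.
apply: filterS => x dx Ox.
by apply/eqP; rewrite -subr_eq0; apply/eqP; exact: dx.
Qed.
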